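(* Let $g:\mathbb R\to\mathbb R$ be real-analytic with $g(0)=0$, $g'(0)=1$, and let $G(x)=\int_0^xg(s)\,ds$. Suppose there exist $a<0<b$ and $c>0$ such that $G(a)=G(b)=c$, and $G(x)<c$ and $x\,g(x)>0$ for all $a<x<b$, $x\ne0$. Then the equation $\ddot x+g(x)=0$ has an isochronous center at $0$ if and only if there exists a function $F$, real-analytic in some neighborhood of $0$, such that $$2G(x)-x\,g(x)=g(x)\,F(G(x))$$ for all $x$ in a neighborhood of $0$.
   Context: The equation $\ddot x+g(x)=0$ is identified with the planar system $\dot x=y$, $\dot y=-g(x)$. The center at the origin is called isochronous if all periodic orbits near $(0,0)$ have the same minimal period (which is then $2\pi$). *)

(* Defs.v *)
From Stdlib Require Import Reals.
From Coquelicot Require Import Coquelicot.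
Open Scope R_scope.

Definition analytic_at (f : R -> R) (x0 : R) : Prop :=
  exists a : nat -> R, locally x0 (fun x => is_pseries a (x - x0) (f x)).

Definition potential (g : R -> R) (x : R) : R := RInt g 0 x.

Definition solution (g x y : R -> R) : Prop :=
  forall t : R, is_derive x t (y t) /\ is_derive y t (- g (x t)).

Definition is_period (x y : R -> R) (T : R) : Prop :=
  0 < T /\ forall t : R, x (t + T) = x t /\ y (t + T) = y t.

Definition minimal_period (x y : R -> R) (T : R) : Prop :=
  is_period x y T /\ forall S : R, is_period x y S -> T <= S.

(* Equilibria are excluded: a periodic orbit is a nonconstant periodic
   solution. *)
Definition periodic_orbit (g x y : R -> R) : Prop :=
  solution g x y /\ (exists T : R, is_period x y T) /\
  exists t : R, (x t, y t) <> (x 0, y 0).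

(* The origin has an open neighbourhood U such that U minus the origin is a
   union of periodic orbits. *)
Definition center_at_origin (g : R -> R) : Prop :=
  exists U : R * R -> Prop, open U /\ U (0, 0) /\
    forall p : R * R, U p -> p <> (0, 0) ->
      exists x y : R -> R, periodic_orbit g x y /\ (x 0, y 0) = p /\
        forall t : R, U (x t, y t) /\ (x t, y t) <> (0, 0).

(* The common period T is not prescribed: T = 2 * PI is a consequence of
   g'(0) = 1. *)
Definition isochronous_center_at_origin (g : R -> R) : Prop :=
  center_at_origin g /\
  exists (T : R) (U : R * R -> Prop), open U /\ U (0, 0) /\
    forall x y : R -> R, periodic_orbit g x y ->
      (forall t : R, U (x t, y t)) -> minimal_period x y T.

(* Main.v *)
Require Import Defs.
From Stdlib Require Import Reals Lra Lia Ranalysis5 ClassicalEpsilon.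
From Coquelicot Require Import Coquelicot.
Open Scope R_scope.

(** In the energy coordinate [u = sgn x * sqrt (2 * G x)], whose inverse [X] is
    analytic with [X'(0) = 1], the orbits are the circles [u = r sin theta],
    [y = r cos theta], traversed with [dt = X'(r sin theta) dtheta].  The period of
    the orbit of radius [r] is therefore the integral of [X'(r sin theta)] over a
    full turn, which sees only the even part of [X'].  It does not depend on [r]
    iff that even part is constant: otherwise, zeros of analytic functions being
    isolated, its difference with [T / (2 PI)] has a constant sign on some
    interval [(0, r)], and its integral cannot vanish.

    Since [g (X u) = u / X' u], the equation [2 G - x g = g F(G)] becomes
    [u X' u - X u = F (u^2 / 2)], that is, the left-hand side is even; the odd part
    [o] of [X] then satisfies [u o' = o], so [o u = u] and the even part of [X'] is
    [1].  Conversely, if the even part of [X'] is [1], then [F] is read off the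
    power series of [u X' u - X u].

    The power series of [X] is [u W u], where [W] is the formal solution of
    [W^2 (1 + p (u W)) = 1] with [2 G x = x^2 (1 + p x)]; weighted l1 norms give
    its convergence, and also the analyticity of [F] away from [0]. *)

(** * Weighted l1 bounds on power series *)

Lemma partial_sum_le_series (u : nat -> R) (l : R) :
  (forall n, 0 <= u n) -> is_series u l -> forall n, sum_f_R0 u n <= l.
Proof.
  intros Hu Hl n.
  rewrite <- sum_n_Reals.
  apply (is_lim_seq_incr_compare (sum_n u)).
  - exact Hl.
  - intros k. rewrite sum_Sn. unfold plus; simpl. specialize (Hu (S k)). lra.
Qed.

Lemma bounded_partial_sums (u : nat -> R) (M : R) :
  (forall n, 0 <= u n) -> (forall n, sum_f_R0 u n <= M) ->
  ex_series u /\ Series u <= M.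
Proof.
  intros Hu HM.
  assert (Hex : ex_series u).
  { destruct (ex_finite_lim_seq_incr (sum_n u) M) as [l Hl].
    - intros k. rewrite sum_Sn. unfold plus; simpl. specialize (Hu (S k)). lra.
    - intros k. rewrite sum_n_Reals. apply HM.
    - exists l. exact Hl. }
  split; [exact Hex|].
  apply (is_lim_seq_le (sum_n u) (fun _ => M) (Series u) M).
  - intros k. rewrite sum_n_Reals. apply HM.
  - exact (Series_correct _ Hex).
  - apply is_lim_seq_const.
Qed.

Lemma ex_series_dominated (u M : nat -> R) :
  (forall n, Rabs (u n) <= M n) -> ex_series M ->
  ex_series (fun n => Rabs (u n)) /\ ex_series u /\ Rabs (Series u) <= Series M.
Proof.
  intros HM Hex.
  assert (Ha : ex_series (fun n => Rabs (u n))).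
  { apply (ex_series_le (fun n => Rabs (u n)) M); [|exact Hex].
    intros n. unfold norm; simpl. unfold abs; simpl. rewrite Rabs_Rabsolu. apply HM. }
  split; [exact Ha|]. split; [now apply ex_series_Rabs|].
  eapply Rle_trans; [now apply Series_Rabs|].
  apply Series_le; [|exact Hex].
  intros n. split; [apply Rabs_pos|apply HM].
Qed.

Lemma Series_sum_swap (a : nat -> nat -> R) (N : nat) :
  (forall n, ex_series (fun k => a k n)) ->
  ex_series (fun k => sum_f_R0 (a k) N) /\
  Series (fun k => sum_f_R0 (a k) N) = sum_f_R0 (fun n => Series (fun k => a k n)) N.
Proof.
  intros H. induction N as [|N [IH1 IH2]]; simpl.
  - split; [apply H|reflexivity].
  - split.
    + apply (ex_series_plus (fun k => sum_f_R0 (a k) N) (fun k => a k (S N))); auto.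
    + rewrite <- IH2. apply Series_plus; auto.
Qed.

Lemma is_lim_seq_sum_0 (d : nat -> nat -> R) (K : nat) :
  (forall k, is_lim_seq (d k) 0) ->
  is_lim_seq (fun N => sum_f_R0 (fun k => d k N) K) 0.
Proof.
  intros H. induction K as [|K IH]; simpl; [apply H|].
  replace (Finite 0) with (Finite (0 + 0)) by (f_equal; ring).
  now apply is_lim_seq_plus'.
Qed.

(** Dominated convergence: past some [K] the terms are controlled by the tail of [M], uniformly in
    [N], while the first [K + 1] terms form a finite sum of null sequences. *)
Lemma is_lim_seq_Series_dominated (d : nat -> nat -> R) (M : nat -> R) :
  (forall k N, Rabs (d k N) <= M k) -> ex_series M ->
  (forall k, is_lim_seq (d k) 0) ->
  is_lim_seq (fun N => Series (fun k => d k N)) 0.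
Proof.
  intros HM Hex Hlim.
  apply is_lim_seq_spec. intros eps.
  assert (Htail : exists K, Rabs (Series M - sum_f_R0 M K) < eps / 2).
  { pose proof (Series_correct _ Hex) as Hs.
    assert (Hs' : is_lim_seq (sum_n M) (Series M)) by exact Hs.
    apply is_lim_seq_spec in Hs'.
    assert (He : 0 < eps / 2) by (destruct eps; simpl; lra).
    destruct (Hs' (mkposreal _ He)) as [K HK]. simpl in HK.
    exists K. rewrite <- sum_n_Reals, Rabs_minus_sym. apply HK. lia. }
  destruct Htail as [K HK].
  assert (He : 0 < eps / 2) by (destruct eps; simpl; lra).
  pose proof (is_lim_seq_sum_0 d K Hlim) as H0.
  apply is_lim_seq_spec in H0.
  destruct (H0 (mkposreal _ He)) as [N0 HN0]. simpl in HN0.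
  exists N0. intros N HN. specialize (HN0 N HN).
  rewrite Rminus_0_r in *.
  destruct (ex_series_dominated (fun k => d k N) M) as [_ [Hd _]]; auto.
  rewrite (Series_incr_n (fun k => d k N) (S K)); [|lia|exact Hd].
  simpl pred.
  destruct (ex_series_dominated (fun k => d (S K + k)%nat N) (fun k => M (S K + k)%nat))
    as [_ [_ Ht]]; auto.
  { now apply (ex_series_incr_n M (S K)). }
  rewrite (Series_incr_n M (S K)) in HK; [|lia|exact Hex].
  simpl pred in HK.
  replace (sum_f_R0 M K + Series (fun k => M (S K + k)%nat) - sum_f_R0 M K)
    with (Series (fun k => M (S K + k)%nat)) in HK by ring.
  pose proof (Rle_abs (Series (fun k => M (S K + k)%nat))).
  eapply Rle_lt_trans; [apply Rabs_triang|]. lra.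
Qed.

(** Fubini for double series. Finite sums over [n] commute with the sum over [k], so only the sum
    over [k] of the row remainders has to vanish; each remainder is at most [2 * M k], and dominated
    convergence applies. *)
Lemma is_series_exchange (a : nat -> nat -> R) (M : nat -> R) :
  (forall k n, sum_f_R0 (fun i => Rabs (a k i)) n <= M k) -> ex_series M ->
  is_series (fun n => Series (fun k => a k n)) (Series (fun k => Series (a k))).
Proof.
  intros HM Hex.
  assert (Hrow : forall k, ex_series (a k)).
  { intros k. apply ex_series_Rabs.
    apply (bounded_partial_sums (fun i => Rabs (a k i)) (M k)); auto.
    intros; apply Rabs_pos. }
  assert (Habs : forall k n, Rabs (sum_f_R0 (a k) n) <= M k).
  { intros k n. eapply Rle_trans; [apply Rsum_abs|apply HM]. }
  assert (Hterm : forall k n, Rabs (a k n) <= M k).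
  { intros k n. eapply Rle_trans; [|apply (HM k n)].
    destruct n; simpl; [lra|].
    assert (0 <= sum_f_R0 (fun i => Rabs (a k i)) n)
      by (apply cond_pos_sum; intros; apply Rabs_pos). lra. }
  assert (Hrowb : forall k, Rabs (Series (a k)) <= M k).
  { intros k. destruct (bounded_partial_sums (fun i => Rabs (a k i)) (M k)) as [H1 H2]; auto.
    - intros; apply Rabs_pos.
    - eapply Rle_trans; [now apply Series_Rabs|exact H2]. }
  assert (Hcol : forall n, ex_series (fun k => a k n)).
  { intros n. now apply (ex_series_dominated (fun k => a k n) M). }
  assert (Hrows : ex_series (fun k => Series (a k)))
    by now apply (ex_series_dominated (fun k => Series (a k)) M).
  assert (Hd : is_lim_seq (fun N => Series (fun k => Series (a k) - sum_f_R0 (a k) N)) 0).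
  { apply (is_lim_seq_Series_dominated _ (fun k => 2 * M k)).
    - intros k N. eapply Rle_trans; [apply Rabs_triang|].
      rewrite Rabs_Ropp. specialize (Habs k N). specialize (Hrowb k). lra.
    - now apply (ex_series_scal_l 2 M).
    - intros k. replace (Finite 0) with (Finite (Series (a k) - Series (a k)))
        by (f_equal; ring).
      apply is_lim_seq_minus'; [apply is_lim_seq_const|].
      apply (is_lim_seq_ext (sum_n (a k))); [intros; apply sum_n_Reals|].
      exact (Series_correct _ (Hrow k)). }
  change (is_lim_seq (sum_n (fun n => Series (fun k => a k n)))
           (Series (fun k => Series (a k)))).
  apply (is_lim_seq_ext (fun N => Series (fun k => Series (a k)) -
    Series (fun k => Series (a k) - sum_f_R0 (a k) N))).
  { intros N. destruct (Series_sum_swap a N Hcol) as [H1 H2].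
    rewrite Series_minus; auto. rewrite H2, sum_n_Reals. ring. }
  replace (Finite (Series (fun k => Series (a k))))
    with (Finite (Series (fun k => Series (a k)) - 0)) by (f_equal; ring).
  apply is_lim_seq_minus'; [apply is_lim_seq_const|exact Hd].
Qed.

(** [M] bounds the weighted norm of [a], the sum of [|a i| r^i]. Bounding partial sums packages
    convergence and estimate in one statement that is easy to propagate. *)
Definition l1_bound (r : R) (a : nat -> R) (M : R) : Prop :=
  forall n, sum_f_R0 (fun i => Rabs (a i) * r ^ i) n <= M.

Lemma l1_term_pos (r : R) (a : nat -> R) (i : nat) : 0 <= r -> 0 <= Rabs (a i) * r ^ i.
Proof. intros. apply Rmult_le_pos; [apply Rabs_pos|now apply pow_le]. Qed.

Lemma l1_bound_le (r : R) (a : nat -> R) (M M' : R) :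
  l1_bound r a M -> M <= M' -> l1_bound r a M'.
Proof. intros H H' n. specialize (H n). lra. Qed.

Lemma l1_bound_pos (r : R) (a : nat -> R) (M : R) : l1_bound r a M -> 0 <= M.
Proof.
  intros H. specialize (H 0%nat). simpl in H. pose proof (Rabs_pos (a 0%nat)). lra.
Qed.

Lemma l1_bound_term (r : R) (a : nat -> R) (M : R) (n : nat) :
  0 <= r -> l1_bound r a M -> Rabs (a n) * r ^ n <= M.
Proof.
  intros Hr H. eapply Rle_trans; [|apply (H n)].
  destruct n; [simpl; lra|]. rewrite tech5.
  assert (0 <= sum_f_R0 (fun i => Rabs (a i) * r ^ i) n)
    by (apply cond_pos_sum; intros; now apply l1_term_pos). lra.
Qed.

Lemma l1_bound_plus (r : R) (a b : nat -> R) (A B : R) :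
  0 <= r -> l1_bound r a A -> l1_bound r b B -> l1_bound r (PS_plus a b) (A + B).
Proof.
  intros Hr Ha Hb n.
  eapply Rle_trans with (sum_f_R0 (fun i => Rabs (a i) * r ^ i + Rabs (b i) * r ^ i) n).
  - apply sum_Rle. intros i _. rewrite <- Rmult_plus_distr_r.
    apply Rmult_le_compat_r; [now apply pow_le|apply Rabs_triang].
  - rewrite plus_sum. specialize (Ha n). specialize (Hb n). lra.
Qed.

Lemma l1_bound_scal (r c : R) (a : nat -> R) (A : R) :
  l1_bound r a A -> l1_bound r (PS_scal c a) (Rabs c * A).
Proof.
  intros Ha n.
  eapply Rle_trans; [|apply Rmult_le_compat_l; [apply Rabs_pos|apply (Ha n)]].
  rewrite scal_sum. right. apply sum_eq. intros i _.
  unfold PS_scal, scal; simpl; unfold mult; simpl. rewrite Rabs_mult. ring.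
Qed.

Lemma l1_bound_incr_1 (r : R) (a : nat -> R) (A : R) :
  0 <= r -> l1_bound r a A -> l1_bound r (PS_incr_1 a) (r * A).
Proof.
  intros Hr Ha n.
  destruct n as [|n].
  - simpl. unfold zero; simpl. rewrite Rabs_R0.
    pose proof (l1_bound_pos _ _ _ Ha). assert (0 <= r * A) by now apply Rmult_le_pos. lra.
  - rewrite decomp_sum by lia. simpl pred.
    unfold PS_incr_1 at 1. unfold zero; simpl. rewrite Rabs_R0.
    eapply Rle_trans; [|apply Rmult_le_compat_l; [exact Hr|apply (Ha n)]].
    rewrite scal_sum. right. rewrite Rmult_0_l, Rplus_0_l. apply sum_eq. intros i _. ring.
Qed.

(** Submultiplicativity of the norm: since [r^i = r^k r^(i-k)], the weighted terms of the product
    are dominated by the Cauchy product of two nonnegative series, whose sum is at most [A * B]. *)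
Lemma l1_bound_mult (r : R) (a b : nat -> R) (A B : R) :
  0 <= r -> l1_bound r a A -> l1_bound r b B -> l1_bound r (PS_mult a b) (A * B).
Proof.
  intros Hr Ha Hb n.
  destruct (bounded_partial_sums (fun i => Rabs (a i) * r ^ i) A) as [Ea La]; auto.
  { intros; now apply l1_term_pos. }
  destruct (bounded_partial_sums (fun i => Rabs (b i) * r ^ i) B) as [Eb Lb]; auto.
  { intros; now apply l1_term_pos. }
  pose proof (is_series_mult_pos _ _ _ _ (Series_correct _ Ea) (Series_correct _ Eb)
    (fun n => l1_term_pos r a n Hr) (fun n => l1_term_pos r b n Hr)) as H.
  assert (Pa : 0 <= Series (fun i => Rabs (a i) * r ^ i)).
  { eapply Rle_trans; [|apply (partial_sum_le_series _ _ (fun n => l1_term_pos r a n Hr)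
      (Series_correct _ Ea) 0)]. simpl. pose proof (Rabs_pos (a 0%nat)). lra. }
  assert (Pb : 0 <= Series (fun i => Rabs (b i) * r ^ i)).
  { eapply Rle_trans; [|apply (partial_sum_le_series _ _ (fun n => l1_term_pos r b n Hr)
      (Series_correct _ Eb) 0)]. simpl. pose proof (Rabs_pos (b 0%nat)). lra. }
  eapply Rle_trans; [|apply Rmult_le_compat; [exact Pa|exact Pb|exact La|exact Lb]].
  eapply Rle_trans; [|apply (partial_sum_le_series _ _ (fun m =>
    cond_pos_sum _ m (fun k => Rmult_le_pos _ _ (l1_term_pos r a k Hr)
      (l1_term_pos r b (m - k) Hr))) H n)].
  apply sum_Rle. intros i _. unfold PS_mult.
  eapply Rle_trans; [apply Rmult_le_compat_r; [now apply pow_le|apply Rsum_abs]|].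
  rewrite Rmult_comm, scal_sum. right. apply sum_eq. intros k Hk.
  rewrite Rabs_mult. replace (r ^ i) with (r ^ k * r ^ (i - k)).
  - ring.
  - rewrite <- pow_add. f_equal. lia.
Qed.

Lemma l1_bound_CV_radius (r : R) (a : nat -> R) (M : R) :
  0 <= r -> l1_bound r a M -> Rbar_le r (CV_radius a).
Proof.
  intros Hr H. apply CV_radius_bounded. exists M. intros n.
  rewrite Rabs_mult, (Rabs_pos_eq (r ^ n)) by now apply pow_le.
  now apply l1_bound_term.
Qed.

Lemma l1_bound_lt_CV_radius (r : R) (a : nat -> R) (M u : R) :
  l1_bound r a M -> Rabs u < r -> Rbar_lt (Rabs u) (CV_radius a).
Proof.
  intros H Hu. pose proof (Rabs_pos u).
  eapply Rbar_lt_le_trans; [|apply (l1_bound_CV_radius r a M); [lra|exact H]].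
  exact Hu.
Qed.

Lemma l1_bound_partial (r : R) (a : nat -> R) (M u : R) :
  l1_bound r a M -> Rabs u <= r -> forall n, sum_f_R0 (fun i => Rabs (a i * u ^ i)) n <= M.
Proof.
  intros H Hu n. eapply Rle_trans; [|apply (H n)]. apply sum_Rle. intros i _.
  rewrite Rabs_mult, <- RPow_abs. apply Rmult_le_compat_l; [apply Rabs_pos|].
  apply pow_incr. split; [apply Rabs_pos|exact Hu].
Qed.

Lemma l1_bound_PSeries (r : R) (a : nat -> R) (M u : R) :
  l1_bound r a M -> Rabs u <= r ->
  is_pseries a u (PSeries a u) /\ Rabs (PSeries a u) <= M.
Proof.
  intros H Hu. pose proof (l1_bound_partial _ _ _ _ H Hu) as Hp.
  destruct (bounded_partial_sums (fun i => Rabs (a i * u ^ i)) M) as [He Hle]; auto.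
  { intros; apply Rabs_pos. }
  split.
  - apply PSeries_correct, ex_pseries_R, ex_series_Rabs, He.
  - unfold PSeries. eapply Rle_trans; [now apply Series_Rabs|exact Hle].
Qed.

Lemma CV_radius_l1_bound (a : nat -> R) (r : R) :
  0 <= r -> Rbar_lt r (CV_radius a) -> exists M, l1_bound r a M.
Proof.
  intros Hr H. rewrite <- (Rabs_pos_eq r) in H by exact Hr.
  apply CV_disk_inside in H. exists (Series (fun n => Rabs (a n * r ^ n))).
  intros n.
  eapply Rle_trans; [|apply (partial_sum_le_series _ _ (fun n => Rabs_pos _)
    (Series_correct _ H) n)].
  right. apply sum_eq. intros i _. now rewrite Rabs_mult, (Rabs_pos_eq (r ^ i)) by now apply pow_le.
Qed.

(** Completeness of the weighted space: a norm-summable family of power series can be added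
    coefficient by coefficient, and evaluation commutes with the sum by the exchange of
    summations. *)
Lemma l1_bound_Series (r : R) (q : nat -> nat -> R) (M : nat -> R) :
  0 < r -> (forall k, l1_bound r (q k) (M k)) -> ex_series M ->
  l1_bound r (fun n => Series (fun k => q k n)) (Series M) /\
  forall u, Rabs u <= r ->
    PSeries (fun n => Series (fun k => q k n)) u = Series (fun k => PSeries (q k) u).
Proof.
  intros Hr Hq HM.
  assert (Hcol : forall n, ex_series (fun k => Rabs (q k n) * r ^ n) /\
     Rabs (Series (fun k => q k n)) * r ^ n <= Series (fun k => Rabs (q k n) * r ^ n)).
  { intros n.
    (* A norm bound controls each coefficient: [|q k n| <= M k / r^n]. *)
    destruct (ex_series_dominated (fun k => q k n) (fun k => M k * / r ^ n)) as [H1 [H2 _]].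
    - intros k. apply Rmult_le_reg_r with (r ^ n); [now apply pow_lt|].
      rewrite Rmult_assoc, Rinv_l, Rmult_1_r by (apply pow_nonzero; lra).
      apply l1_bound_term; [lra|apply Hq].
    - apply (ex_series_scal_r (/ r ^ n) M), HM.
    - split; [apply (ex_series_scal_r (r ^ n)), H1|].
      rewrite Series_scal_r. apply Rmult_le_compat_r; [apply pow_le; lra|].
      now apply Series_Rabs. }
  split.
  - intros N.
    eapply Rle_trans with (sum_f_R0 (fun n => Series (fun k => Rabs (q k n) * r ^ n)) N).
    { apply sum_Rle. intros n _. apply Hcol. }
    destruct (Series_sum_swap (fun k n => Rabs (q k n) * r ^ n) N) as [H1 H2].
    { intros n. apply Hcol. }
    rewrite <- H2. apply Series_le; [|exact HM].
    intros k. split; [|apply Hq].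
    apply cond_pos_sum. intros; apply l1_term_pos; lra.
  - intros u Hu. unfold PSeries at 1.
    rewrite (Series_ext _ (fun n => Series (fun k => q k n * u ^ n)))
      by (intros; now rewrite Series_scal_r).
    apply is_series_unique.
    apply (is_series_exchange (fun k n => q k n * u ^ n) M); [|exact HM].
    intros k n. now apply l1_bound_partial with r.
Qed.

(** * Composition and recentring of power series *)

Definition PS_one (n : nat) : R := match n with O => 1 | S _ => 0 end.

Fixpoint PS_pow (b : nat -> R) (k : nat) : nat -> R :=
  match k with O => PS_one | S k => PS_mult b (PS_pow b k) end.

(** The coefficient is an infinite sum over [k], not truncated at [n], so that [b] may have a
    nonzero constant term; recentring uses this. *)
Definition PS_comp (p b : nat -> R) (n : nat) : R :=
  Series (fun k => p k * PS_pow b k n).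

Lemma l1_bound_one (r : R) : l1_bound r PS_one 1.
Proof.
  intros n. induction n as [|n IH]; simpl; [rewrite Rabs_R1; lra|].
  rewrite Rabs_R0. simpl in IH. lra.
Qed.

Lemma PSeries_one (u : R) : PSeries PS_one u = 1.
Proof.
  unfold PSeries.
  assert (H : ex_series (fun n => PS_one n * u ^ n)).
  { apply ex_series_Rabs, (bounded_partial_sums _ 1); [intros; apply Rabs_pos|].
    apply (l1_bound_partial (Rabs u)); [apply l1_bound_one|lra]. }
  rewrite Series_incr_1 by exact H. simpl.
  rewrite (Series_ext _ (fun k => 0 * u ^ S k)) by reflexivity.
  rewrite Series_scal_l. ring.
Qed.

Lemma l1_bound_pow (r : R) (b : nat -> R) (B : R) (k : nat) :
  0 <= r -> l1_bound r b B -> l1_bound r (PS_pow b k) (B ^ k).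
Proof.
  intros Hr Hb. induction k as [|k IH]; simpl; [apply l1_bound_one|].
  now apply l1_bound_mult.
Qed.

Lemma PSeries_pow (r : R) (b : nat -> R) (B u : R) (k : nat) :
  l1_bound r b B -> Rabs u < r -> PSeries (PS_pow b k) u = PSeries b u ^ k.
Proof.
  intros Hb Hu. pose proof (Rabs_pos u).
  induction k as [|k IH]; simpl; [apply PSeries_one|].
  rewrite PSeries_mult, IH; [reflexivity| |].
  - now apply (l1_bound_lt_CV_radius r b B).
  - apply (l1_bound_lt_CV_radius r _ (B ^ k)); [|exact Hu].
    apply l1_bound_pow; [lra|exact Hb].
Qed.

(** The norm of [b] serves as the weight for [p]: [PS_pow b k] has norm at most [B^k], so the
    summands [p k * b^k] have total norm at most the norm of [p] at radius [B]. *)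
Lemma l1_bound_comp (r : R) (p b : nat -> R) (P B : R) :
  0 < r -> l1_bound B p P -> l1_bound r b B ->
  l1_bound r (PS_comp p b) P /\
  forall u, Rabs u < r -> PSeries (PS_comp p b) u = PSeries p (PSeries b u).
Proof.
  intros Hr Hp Hb.
  pose proof (l1_bound_pos _ _ _ Hb) as HB.
  destruct (bounded_partial_sums (fun i => Rabs (p i) * B ^ i) P) as [He Hle]; auto.
  { intros; now apply l1_term_pos. }
  destruct (l1_bound_Series r (fun k => PS_scal (p k) (PS_pow b k))
    (fun k => Rabs (p k) * B ^ k)) as [H1 H2]; auto.
  { intros k. apply l1_bound_scal, l1_bound_pow; [lra|exact Hb]. }
  split.
  - eapply l1_bound_le; [exact H1|exact Hle].
  - intros u Hu. unfold PS_comp. rewrite H2 by lra.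
    unfold PSeries at 2. apply Series_ext. intros k.
    rewrite PSeries_scal. f_equal. now apply PSeries_pow with r B.
Qed.

Lemma PSeries_affine (x0 u : R) :
  PSeries (PS_plus (PS_scal x0 PS_one) (PS_incr_1 PS_one)) u = x0 + u.
Proof.
  assert (H : ex_pseries PS_one u).
  { apply ex_pseries_R. apply ex_series_Rabs.
    apply (bounded_partial_sums _ 1); [intros; apply Rabs_pos|].
    intros n. apply (l1_bound_partial (Rabs u)); [apply l1_bound_one|lra]. }
  rewrite PSeries_plus.
  - rewrite PSeries_scal, PSeries_incr_1, PSeries_one. ring.
  - apply ex_pseries_scal; [unfold mult; simpl; ring|exact H].
  - now apply ex_pseries_incr_1.
Qed.

(** Recentring is composition with the affine series [x0 + u]. For [B] between [|x0|] and the radius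
    of convergence, that series has norm at most [B] at radius [B - |x0|]. *)
Lemma analytic_at_PSeries (p : nat -> R) (x0 : R) :
  Rbar_lt (Rabs x0) (CV_radius p) -> analytic_at (PSeries p) x0.
Proof.
  intros Hx.
  assert (HB : exists B, Rabs x0 < B /\ Rbar_lt B (CV_radius p)).
  { destruct (CV_radius p) as [c| |]; simpl in *.
    - exists ((Rabs x0 + c) / 2). lra.
    - exists (Rabs x0 + 1). split; [lra|exact I].
    - tauto. }
  destruct HB as [B [HB1 HB2]]. pose proof (Rabs_pos x0).
  destruct (CV_radius_l1_bound p B) as [P HP]; [lra|exact HB2|].
  set (b := PS_plus (PS_scal x0 PS_one) (PS_incr_1 PS_one)).
  set (r := B - Rabs x0).
  assert (Hr : 0 < r) by (unfold r; lra).
  assert (Hb : l1_bound r b B).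
  { eapply l1_bound_le.
    - apply l1_bound_plus; [lra|apply l1_bound_scal, l1_bound_one|].
      apply l1_bound_incr_1; [lra|apply l1_bound_one].
    - unfold r; lra. }
  destruct (l1_bound_comp r p b P B Hr HP Hb) as [H1 H2].
  exists (PS_comp p b). exists (mkposreal r Hr). intros x Hxr.
  assert (Hxr' : Rabs (x - x0) < r) by exact Hxr.
  destruct (l1_bound_PSeries r (PS_comp p b) P (x - x0) H1 (Rlt_le _ _ Hxr')) as [H3 _].
  rewrite H2 in H3 by exact Hxr'. unfold b in H3. rewrite PSeries_affine in H3.
  rewrite Rplus_minus in H3. exact H3.
Qed.

(** * A formal implicit function *)

(** Congruence modulo [u^n], for the contraction argument in the [u]-adic sense. *)
Definition agree (n : nat) (a b : nat -> R) : Prop := forall i, (i < n)%nat -> a i = b i.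

Lemma agree_plus (n : nat) (a a' b b' : nat -> R) :
  agree n a a' -> agree n b b' -> agree n (PS_plus a b) (PS_plus a' b').
Proof. intros H1 H2 i Hi. unfold PS_plus. now rewrite H1, H2. Qed.

Lemma agree_incr_1 (n : nat) (a a' : nat -> R) :
  agree n a a' -> agree (S n) (PS_incr_1 a) (PS_incr_1 a').
Proof. intros H i Hi. destruct i; simpl; [reflexivity|]. apply H. lia. Qed.

Lemma agree_mult (n : nat) (a a' b b' : nat -> R) :
  agree n a a' -> agree n b b' -> agree n (PS_mult a b) (PS_mult a' b').
Proof.
  intros H1 H2 i Hi. unfold PS_mult. apply sum_eq. intros k Hk.
  rewrite H1, H2 by lia. reflexivity.
Qed.

(** One order is gained because, in the coefficient of index [n], the uncontrolled term [a n] is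
    multiplied by [b 0 = 0]. *)
Lemma agree_mult_S (n : nat) (a a' b b' : nat -> R) :
  agree n a a' -> agree (S n) b b' -> b 0%nat = 0 -> b' 0%nat = 0 ->
  agree (S n) (PS_mult a b) (PS_mult a' b').
Proof.
  intros H1 H2 H3 H4 i Hi. unfold PS_mult. apply sum_eq. intros k Hk.
  rewrite (H2 (i - k)%nat) by lia.
  destruct (Nat.eq_dec k n) as [->|Hn].
  - replace (i - n)%nat with 0%nat by lia. rewrite H4. ring.
  - rewrite H1 by lia. reflexivity.
Qed.

Lemma agree_pow (n : nat) (b b' : nat -> R) (k : nat) :
  agree n b b' -> agree n (PS_pow b k) (PS_pow b' k).
Proof.
  intros H. induction k as [|k IH]; simpl; [now intros i _|]. now apply agree_mult.
Qed.

Lemma agree_comp (n : nat) (p b b' : nat -> R) :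
  agree n b b' -> agree n (PS_comp p b) (PS_comp p b').
Proof.
  intros H i Hi. unfold PS_comp. apply Series_ext. intros k. f_equal.
  now apply (agree_pow n).
Qed.

Lemma PS_comp_0 (p b : nat -> R) : p 0%nat = 0 -> b 0%nat = 0 -> PS_comp p b 0%nat = 0.
Proof.
  intros Hp Hb. unfold PS_comp. rewrite (Series_ext _ (fun _ => 0 * 0)).
  - rewrite Series_scal_l. ring.
  - intros [|k]; [rewrite Hp; ring|]. simpl. unfold PS_mult; simpl. rewrite Hb. ring.
Qed.

(* A fixed point [w] solves [(1 + w)^2 (1 + p(u (1 + w))) = 1]: this is
   [2 w + w^2 + (1 + w)^2 p(u (1 + w)) = 0] solved for the linear term. *)
Definition implicit_map (p w : nat -> R) : nat -> R :=
  let W := PS_plus PS_one w in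
  PS_scal (-1/2) (PS_plus (PS_mult w w)
    (PS_mult (PS_mult W W) (PS_comp p (PS_incr_1 W)))).

Lemma implicit_map_0 (p w : nat -> R) :
  p 0%nat = 0 -> w 0%nat = 0 -> implicit_map p w 0%nat = 0.
Proof.
  intros Hp Hw. unfold implicit_map, PS_scal, PS_plus, PS_mult at 1 2; simpl.
  rewrite PS_comp_0; [|exact Hp|reflexivity].
  rewrite Hw. unfold scal, plus; simpl; unfold mult; simpl. ring.
Qed.

(** The map is a formal contraction. In [w^2] the top coefficient is always paired with [w 0 = 0];
    in the other term [w] enters [p] through [u (1 + w)], which shifts the agreement by one, and the
    prefactor meets the vanishing constant term of the composite. *)
Lemma implicit_map_agree (n : nat) (p v w : nat -> R) :
  p 0%nat = 0 -> v 0%nat = 0 -> w 0%nat = 0 ->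
  agree n v w -> agree (S n) (implicit_map p v) (implicit_map p w).
Proof.
  intros Hp Hv Hw H.
  assert (HW : agree n (PS_plus PS_one v) (PS_plus PS_one w))
    by (apply agree_plus; [now intros i _|exact H]).
  assert (Hvw : agree (S n) (PS_mult v v) (PS_mult w w)).
  { intros i Hi. unfold PS_mult. apply sum_eq. intros k Hk.
    destruct (Nat.eq_dec k 0) as [->|H0]; [rewrite Hv, Hw; ring|].
    destruct (Nat.eq_dec k i) as [->|H1].
    - rewrite Nat.sub_diag, Hv, Hw. ring.
    - rewrite !H by lia. reflexivity. }
  intros i Hi. unfold implicit_map, PS_scal. f_equal.
  apply (agree_plus (S n)); [exact Hvw| |exact Hi].
  apply agree_mult_S; [now apply agree_mult| |now apply PS_comp_0|now apply PS_comp_0].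
  now apply agree_comp, agree_incr_1.
Qed.

(** The constants are balanced so that the ball of radius [1/2] is preserved: [1/2 * (1/2 * 1/2 +
    3/2 * 3/2 * 1/3) = 1/2]. *)
Lemma implicit_map_bound (r : R) (p w : nat -> R) :
  0 < r -> l1_bound (r * (3 / 2)) p (1 / 3) ->
  l1_bound r w (1 / 2) -> l1_bound r (implicit_map p w) (1 / 2).
Proof.
  intros Hr Hp Hw.
  assert (HW : l1_bound r (PS_plus PS_one w) (3 / 2)).
  { eapply l1_bound_le; [apply l1_bound_plus; [lra|apply l1_bound_one|exact Hw]|lra]. }
  eapply l1_bound_le.
  - unfold implicit_map. apply l1_bound_scal. apply l1_bound_plus; [lra| |].
    + apply l1_bound_mult; [lra|exact Hw|exact Hw].
    + apply l1_bound_mult; [lra| |].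
      * apply l1_bound_mult; [lra|exact HW|exact HW].
      * apply (l1_bound_comp r p _ (1 / 3) (r * (3 / 2))); [exact Hr|exact Hp|].
        apply l1_bound_incr_1; [lra|exact HW].
  - replace (-1 / 2) with (- (1 / 2)) by field.
    rewrite Rabs_Ropp, Rabs_pos_eq by lra. lra.
Qed.

Fixpoint implicit_iter (p : nat -> R) (j : nat) : nat -> R :=
  match j with O => fun _ => 0 | S j => implicit_map p (implicit_iter p j) end.

Lemma implicit_iter_0 (p : nat -> R) (j : nat) :
  p 0%nat = 0 -> implicit_iter p j 0%nat = 0.
Proof. intros Hp. induction j; simpl; [reflexivity|]. now apply implicit_map_0. Qed.

Lemma implicit_iter_agree (p : nat -> R) (i j : nat) :
  p 0%nat = 0 -> (i <= j)%nat ->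
  agree (S i) (implicit_iter p i) (implicit_iter p j).
Proof.
  intros Hp. revert j. induction i as [|i IH]; intros j Hij.
  - intros k Hk. replace k with 0%nat by lia. now rewrite !implicit_iter_0.
  - destruct j as [|j]; [lia|]. simpl.
    apply implicit_map_agree; [exact Hp|now apply implicit_iter_0|now apply implicit_iter_0|].
    apply IH. lia.
Qed.

(** Coefficient [n] of the iterates is stationary from step [n] on, so the diagonal is the formal
    limit. Each partial sum of its norm is that of a single iterate, hence the bound passes to the
    limit. *)
Lemma implicit_fixpoint (p : nat -> R) (r : R) :
  p 0%nat = 0 -> 0 < r -> l1_bound (r * (3 / 2)) p (1 / 3) ->
  exists w, w 0%nat = 0 /\ l1_bound r w (1 / 2) /\ forall n, implicit_map p w n = w n.
Proof.
  intros Hp Hr Hb.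
  set (w := fun n => implicit_iter p n n).
  assert (Hw : forall n, agree (S n) w (implicit_iter p n)).
  { intros n i Hi. unfold w. apply (implicit_iter_agree p i n Hp); lia. }
  assert (Hw0 : w 0%nat = 0) by reflexivity.
  exists w. split; [exact Hw0|]. split.
  - assert (Hj : forall j, l1_bound r (implicit_iter p j) (1 / 2)).
    { induction j; simpl; [|now apply implicit_map_bound].
      intros n. rewrite (sum_eq _ (fun _ => 0)).
      - rewrite sum_cte. lra.
      - intros. rewrite Rabs_R0. ring. }
    intros n. rewrite (sum_eq _ (fun i => Rabs (implicit_iter p n i) * r ^ i)); [apply Hj|].
    intros i Hi. now rewrite (Hw n) by lia.
  - intros n.
    rewrite (implicit_map_agree (S n) p w (implicit_iter p n) Hp Hw0
      (implicit_iter_0 p n Hp) (Hw n) n) by lia.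
    symmetry. apply (implicit_iter_agree p n (S n)); [exact Hp|lia|lia].
Qed.

(** As [p] has no constant term, shrinking the radius by a factor [t < 1] shrinks the norm by at
    least [t]. *)
Lemma l1_bound_shrink (p : nat -> R) (R0 P : R) :
  p 0%nat = 0 -> 0 < R0 -> l1_bound R0 p P ->
  exists r, 0 < r /\ l1_bound (r * (3 / 2)) p (1 / 3) /\ r * (3 / 2) < R0.
Proof.
  intros Hp HR HP. pose proof (l1_bound_pos _ _ _ HP) as HP0.
  (* Chosen so that [t * P <= 1/3]; the [+ 1] covers [P = 0]. *)
  set (t := / (3 * (P + 1))).
  assert (Ht0 : 0 < t) by (unfold t; apply Rinv_0_lt_compat; lra).
  assert (Ht : t * (3 * (P + 1)) = 1) by (unfold t; field; lra).
  assert (Ht1 : t < 1) by nra.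
  exists (R0 * t * (2 / 3)).
  replace (R0 * t * (2 / 3) * (3 / 2)) with (R0 * t) by field.
  split; [|split].
  - apply Rmult_lt_0_compat; [now apply Rmult_lt_0_compat|lra].
  - intros n. apply Rle_trans with (t * P); [|nra].
    eapply Rle_trans; [|apply Rmult_le_compat_l; [lra|apply (HP n)]].
    rewrite scal_sum. apply sum_Rle. intros [|i] _.
    + rewrite Hp, Rabs_R0. lra.
    + rewrite Rpow_mult_distr.
      assert (Ht2 : t ^ S i <= t).
      { assert (t ^ i <= 1) by (rewrite <- (pow1 i); apply pow_incr; lra).
        simpl. nra. }
      rewrite <- Rmult_assoc. apply Rmult_le_compat_l; [apply l1_term_pos; lra|exact Ht2].
  - nra.
Qed.

Lemma analytic_implicit (p : nat -> R) (R0 P : R) :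
  p 0%nat = 0 -> 0 < R0 -> l1_bound R0 p P ->
  exists W r, 0 < r /\ W 0%nat = 1 /\ l1_bound r W (3 / 2) /\
    forall u, Rabs u < r ->
      Rabs (u * PSeries W u) < R0 /\
      PSeries W u ^ 2 * (1 + PSeries p (u * PSeries W u)) = 1.
Proof.
  intros Hp HR HP.
  destruct (l1_bound_shrink p R0 P Hp HR HP) as [r [Hr [Hb Hr2]]].
  destruct (implicit_fixpoint p r Hp Hr Hb) as [w [Hw0 [Hw Hfix]]].
  set (W := PS_plus PS_one w).
  assert (HW : l1_bound r W (3 / 2)).
  { eapply l1_bound_le; [apply l1_bound_plus; [lra|apply l1_bound_one|exact Hw]|lra]. }
  exists W, r. split; [exact Hr|]. split.
  { unfold W, PS_plus, plus; simpl. rewrite Hw0. ring. }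
  split; [exact HW|].
  assert (HX : l1_bound r (PS_incr_1 W) (r * (3 / 2))) by (apply l1_bound_incr_1; [lra|exact HW]).
  destruct (l1_bound_comp r p (PS_incr_1 W) (1 / 3) (r * (3 / 2)) Hr Hb HX) as [Hc1 Hc2].
  assert (HWW : l1_bound r (PS_mult W W) (3 / 2 * (3 / 2)))
    by (apply l1_bound_mult; [lra|exact HW|exact HW]).
  intros u Hu. split.
  - destruct (l1_bound_PSeries r W _ u HW (Rlt_le _ _ Hu)) as [_ H].
    rewrite Rabs_mult. pose proof (Rabs_pos u). pose proof (Rabs_pos (PSeries W u)). nra.
  - assert (EW : PSeries W u = 1 + PSeries w u).
    { unfold W. rewrite PSeries_plus, PSeries_one; [reflexivity| |].
      - exists (PSeries PS_one u). apply (l1_bound_PSeries r _ 1); [apply l1_bound_one|lra].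
      - exists (PSeries w u). apply (l1_bound_PSeries r _ (1 / 2)); [exact Hw|lra]. }
    (* The coefficientwise fixed-point equation, evaluated at [u]; with [W = 1 + w] it rearranges to
       [W^2 (1 + p (u W)) = 1]. *)
    assert (E : PSeries w u = -1/2 * (PSeries w u * PSeries w u +
       PSeries W u * PSeries W u * PSeries p (u * PSeries W u))).
    { rewrite <- (PSeries_ext _ _ u Hfix) at 1.
      unfold implicit_map. fold W. rewrite PSeries_scal, PSeries_plus.
      - rewrite !PSeries_mult, Hc2, PSeries_incr_1 by
          (exact Hu || (eapply l1_bound_lt_CV_radius; [eassumption|exact Hu])).
        reflexivity.
      - apply ex_pseries_mult; eapply l1_bound_lt_CV_radius; eassumption.
      - apply ex_pseries_mult; eapply l1_bound_lt_CV_radius; eassumption. }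
    rewrite EW in *. nra.
Qed.

(** * The energy coordinate *)

Lemma analytic_at_0_PSeries (f : R -> R) :
  analytic_at f 0 -> exists a rho, 0 < rho /\ Rbar_lt rho (CV_radius a) /\
    forall x, Rabs x <= rho -> f x = PSeries a x.
Proof.
  (* Convergence at [eps / 2] makes the radius of convergence at least [eps / 2], hence strictly
     larger than [eps / 3]. *)
  intros [a [eps H]]. exists a, (eps / 3).
  pose proof (cond_pos eps) as He.
  assert (H' : forall x, Rabs x < eps -> is_pseries a x (f x)).
  { intros x Hx. rewrite <- (Rminus_0_r x) at 1. apply H.
    unfold ball; simpl; unfold AbsRing_ball, abs, minus, plus, opp; simpl.
    now rewrite Ropp_0, Rplus_0_r. }
  split; [lra|]. split.
  - apply (Rbar_lt_le_trans _ (eps / 2)); [simpl; lra|].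
    apply Rbar_not_lt_le. intros Hlt.
    rewrite <- (Rabs_pos_eq (eps / 2)) in Hlt by lra.
    apply (CV_disk_outside a _ Hlt).
    apply ex_series_lim_0, ex_pseries_R. exists (f (eps / 2)). apply H'.
    rewrite Rabs_pos_eq; lra.
  - intros x Hx. symmetry. apply is_pseries_unique, H'. lra.
Qed.

Lemma locally_Rabs (r x : R) : Rabs x < r -> locally x (fun y => Rabs y < r).
Proof.
  intros H. assert (Hr : 0 < r - Rabs x) by lra.
  exists (mkposreal _ Hr). intros y Hy.
  assert (Hy' : Rabs (y - x) < r - Rabs x) by exact Hy.
  pose proof (Rabs_triang (y - x) x) as Ht.
  rewrite Rplus_comm, Rplus_minus in Ht. lra.
Qed.

Lemma continuous_pos_ball (f : R -> R) (P : R -> Prop) :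
  continuous f 0 -> locally (f 0) P -> exists d, 0 < d /\ forall x, Rabs x < d -> P (f x).
Proof.
  intros Hc HP. destruct (Hc P HP) as [d Hd].
  exists d. split; [apply cond_pos|]. intros x Hx. apply Hd.
  unfold ball; simpl; unfold AbsRing_ball, abs, minus, plus, opp; simpl.
  now rewrite Ropp_0, Rplus_0_r.
Qed.

Lemma continuous_PSeries (a : nat -> R) (x : R) :
  Rbar_lt (Rabs x) (CV_radius a) -> continuous (PSeries a) x.
Proof. intros H. now apply continuity_pt_filterlim, PSeries_continuity. Qed.

Lemma locally_between (l u x : R) : l < x < u -> locally x (fun y => l < y < u).
Proof.
  intros [H1 H2].
  apply filter_and; [apply (open_gt l)|apply (open_lt u)]; assumption.
Qed.

(* [X] is the inverse of [x |-> sgn x sqrt (2 G x)] and [D] its derivative. *)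
Record energy_chart (g X D : R -> R) (r0 delta : R) : Prop := {
  chart_radius : 0 < r0;
  chart_0 : X 0 = 0;
  chart_D0 : D 0 = 1;
  chart_derive : forall u, Rabs u < r0 -> is_derive X u (D u);
  chart_continuous : forall u, Rabs u < r0 -> continuous D u;
  chart_D_ge : forall u, Rabs u < r0 -> 1 / 2 <= D u;
  chart_range : forall u, Rabs u < r0 -> Rabs (X u) < delta;
  chart_potential : forall u, Rabs u < r0 -> potential g (X u) = u ^ 2 / 2;
  chart_force : forall u, Rabs u < r0 -> g (X u) * D u = u;
  chart_lipschitz : forall x y, Rabs x < delta -> Rabs y < delta ->
    Rabs (g x - g y) <= 2 * Rabs (x - y);
  chart_derive_potential : forall x, Rabs x < delta ->
    is_derive (potential g) x (g x) }.

Arguments chart_radius {g X D r0 delta}.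
Arguments chart_0 {g X D r0 delta}.
Arguments chart_D0 {g X D r0 delta}.
Arguments chart_derive {g X D r0 delta}.
Arguments chart_continuous {g X D r0 delta}.
Arguments chart_D_ge {g X D r0 delta}.
Arguments chart_range {g X D r0 delta}.
Arguments chart_potential {g X D r0 delta}.
Arguments chart_force {g X D r0 delta}.
Arguments chart_lipschitz {g X D r0 delta}.
Arguments chart_derive_potential {g X D r0 delta}.

(** The derivative equals [1] at [0], so by continuity it stays below [2] in absolute value nearby,
    and the mean value theorem applies. *)
Lemma lipschitz_near_0 (a : nat -> R) (rho : R) :
  0 < rho -> Rbar_lt rho (CV_radius a) -> a 1%nat = 1 ->
  exists d, 0 < d /\ d <= rho /\ forall x y, Rabs x < d -> Rabs y < d ->
    Rabs (PSeries a x - PSeries a y) <= 2 * Rabs (x - y).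
Proof.
  intros Hrho Hcv Ha1.
  assert (Hin : forall x, Rabs x <= rho -> Rbar_lt (Rabs x) (CV_radius a)).
  { intros x Hx. eapply Rbar_le_lt_trans; [|exact Hcv]. exact Hx. }
  destruct (continuous_pos_ball (PSeries (PS_derive a)) (fun y => -2 < y < 2))
    as [d [Hd H]].
  - apply continuous_PSeries. rewrite CV_radius_derive. apply Hin. rewrite Rabs_R0; lra.
  - apply locally_between. rewrite PSeries_0. unfold PS_derive. rewrite Ha1. simpl. lra.
  - exists (Rmin d rho). split; [now apply Rmin_pos|]. split; [apply Rmin_r|].
    assert (Hd' : forall x, Rabs x < Rmin d rho -> Rabs x < d /\ Rabs x < rho).
    { intros x Hx. pose proof (Rmin_l d rho). pose proof (Rmin_r d rho). lra. }
    intros x y Hx Hy.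
    assert (Hz : forall z, Rmin y x <= z <= Rmax y x -> Rabs z < Rmin d rho).
    { intros z Hz. apply Rabs_def2 in Hx. apply Rabs_def2 in Hy.
      apply Rabs_def1.
      - eapply Rle_lt_trans; [apply Hz|]. apply Rmax_lub_lt; lra.
      - eapply Rlt_le_trans; [|apply Hz]. apply Rmin_glb_lt; lra. }
    destruct (MVT_gen (PSeries a) y x (PSeries (PS_derive a))) as [c [Hc1 Hc2]].
    + intros z Hzz. apply is_derive_PSeries, Hin.
      destruct (Hd' z); [apply Hz|]; lra.
    + intros z Hzz. apply PSeries_continuity, Hin. destruct (Hd' z (Hz z Hzz)). lra.
    + rewrite Hc2, Rabs_mult. apply Rmult_le_compat_r; [apply Rabs_pos|].
      destruct (Hd' c (Hz c Hc1)) as [Hc3 _]. specialize (H c Hc3).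
      apply Rabs_le. lra.
Qed.

Lemma potential_PSeries (g : R -> R) (a : nat -> R) (rho x : R) :
  Rbar_lt rho (CV_radius a) -> (forall x, Rabs x <= rho -> g x = PSeries a x) ->
  Rabs x < rho ->
  potential g x = PSeries (PS_Int a) x /\ is_derive (potential g) x (g x).
Proof.
  intros Hcv Hg Hx.
  assert (HG : forall y, Rabs y < rho -> potential g y = PSeries (PS_Int a) y).
  { intros y Hy. unfold potential. rewrite (RInt_ext g (PSeries a)).
    - apply RInt_PSeries. eapply Rbar_lt_trans; [|exact Hcv]. exact Hy.
    - intros z Hz. apply Hg. apply Rabs_def2 in Hy. apply Rabs_le.
      split.
      + apply Rle_trans with (Rmin 0 y); [apply Rmin_glb; lra|lra].
      + apply Rle_trans with (Rmax 0 y); [lra|apply Rmax_lub; lra]. }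
  split; [now apply HG|].
  apply (is_derive_ext_loc (PSeries (PS_Int a))).
  { apply (filter_imp (fun y => Rabs y < rho)); [|now apply locally_Rabs].
    intros y Hy. symmetry. now apply HG. }
  rewrite Hg by lra.
  rewrite <- (PSeries_ext (PS_derive (PS_Int a)) a).
  - apply is_derive_PSeries. rewrite CV_radius_Int.
    eapply Rbar_lt_trans; [|exact Hcv]. exact Hx.
  - intros n. unfold PS_derive, PS_Int. field. apply not_0_INR. lia.
Qed.

Lemma energy_chart_exists (g : R -> R) :
  analytic_at g 0 -> g 0 = 0 -> is_derive g 0 1 ->
  exists (a : nat -> R) (r0 delta : R), Rbar_lt r0 (CV_radius a) /\
    energy_chart g (PSeries a) (PSeries (PS_derive a)) r0 delta.
Proof.
  intros Han g0 g'0.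
  destruct (analytic_at_0_PSeries g Han) as [gs [rho [Hrho [Hcv Hg]]]].
  assert (Hgs0 : gs 0%nat = 0).
  { rewrite <- g0, Hg by (rewrite Rabs_R0; lra). symmetry. apply PSeries_0. }
  assert (Hgs1 : gs 1%nat = 1).
  { assert (H : is_derive g 0 (PSeries (PS_derive gs) 0)).
    { apply (is_derive_ext_loc (PSeries gs)).
      - apply (filter_imp (fun y => Rabs y < rho)); [|apply locally_Rabs; rewrite Rabs_R0; lra].
        intros y Hy. symmetry. apply Hg. lra.
      - apply is_derive_PSeries. rewrite Rabs_R0.
        eapply Rbar_lt_trans; [|exact Hcv]. exact Hrho. }
    apply is_derive_unique in H. apply is_derive_unique in g'0.
    rewrite PSeries_0 in H. unfold PS_derive in H. simpl in H. lra. }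
  destruct (lipschitz_near_0 gs rho Hrho Hcv Hgs1) as [delta [Hdelta [Hdr Hlip]]].
  destruct (CV_radius_l1_bound gs rho) as [M HM]; [lra|exact Hcv|].
  (* Integrating the series of [g] gives [2 G x = x^2 (1 + p x)]; the leading [1] is [2 * gs 1 / 2],
     which is why [p 0] is set to [0]. *)
  set (p := fun n => match n with O => 0 | S _ => 2 * gs (S n) / INR (S (S n)) end).
  assert (Hp : l1_bound rho p (2 / rho * M)).
  { intros n. apply Rle_trans with
      (sum_f_R0 (fun i => 2 / rho * (Rabs (gs (S i)) * rho ^ S i)) n).
    - apply sum_Rle. intros i _.
      replace (2 / rho * (Rabs (gs (S i)) * rho ^ S i)) with (2 * Rabs (gs (S i)) * rho ^ i)
        by (simpl; field; lra).
      apply Rmult_le_compat_r; [apply pow_le; lra|].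
      pose proof (Rabs_pos (gs (S i))).
      unfold p. destruct i as [|i]; [rewrite Rabs_R0; lra|].
      assert (1 <= INR (S (S (S i)))) by (rewrite !S_INR; pose proof (pos_INR i); lra).
      unfold Rdiv. rewrite !Rabs_mult, Rabs_inv, (Rabs_pos_eq 2), (Rabs_pos_eq (INR _)) by lra.
      rewrite <- (Rmult_1_r (2 * Rabs (gs (S (S i))))) at 2.
      apply Rmult_le_compat_l; [lra|]. rewrite <- Rinv_1. apply Rinv_le_contravar; lra.
    - apply Rle_trans with (2 / rho * sum_f_R0 (fun i => Rabs (gs (S i)) * rho ^ S i) n).
      + right. rewrite scal_sum. apply sum_eq. intros; ring.
      + apply Rmult_le_compat_l; [apply Rlt_le, Rdiv_lt_0_compat; lra|].
        specialize (HM (S n)). rewrite decomp_sum in HM by lia. simpl pred in HM.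
        pose proof (l1_term_pos rho gs 0 (Rlt_le _ _ Hrho)). lra. }
  destruct (analytic_implicit p rho _ eq_refl Hrho Hp) as [W [r [Hr [HW0 [HW Himp]]]]].
  assert (HX : forall u, PSeries (PS_incr_1 W) u = u * PSeries W u)
    by (intros; apply PSeries_incr_1).
  assert (Hcvr : forall u, Rabs u < r -> Rbar_lt (Rabs u) (CV_radius (PS_incr_1 W))).
  { intros u Hu. rewrite CV_radius_incr_1. now apply l1_bound_lt_CV_radius with r (3/2). }
  assert (Hr0 : Rabs 0 < r) by (rewrite Rabs_R0; lra).
  assert (D0 : PSeries (PS_derive (PS_incr_1 W)) 0 = 1).
  { rewrite PSeries_0. unfold PS_derive; simpl. rewrite HW0. ring. }
  destruct (continuous_pos_ball (PSeries (PS_derive (PS_incr_1 W))) (fun y => 1/2 < y < 2))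
    as [d1 [Hd1 HD]].
  { apply continuous_PSeries. rewrite CV_radius_derive. now apply Hcvr. }
  { apply locally_between. rewrite D0. lra. }
  destruct (continuous_pos_ball (PSeries (PS_incr_1 W)) (fun y => - delta < y < delta))
    as [d2 [Hd2 HXr]].
  { apply continuous_PSeries. now apply Hcvr. }
  { apply locally_between. rewrite HX. lra. }
  (* The three bounds keep [u] inside the convergence disc, [D u] above [1/2], and [X u] within
     [delta]. *)
  set (r0 := Rmin (r / 2) (Rmin d1 d2)).
  assert (Hr0pos : 0 < r0) by (unfold r0; repeat apply Rmin_pos; lra).
  assert (Hle : r0 <= r / 2 /\ r0 <= d1 /\ r0 <= d2).
  { unfold r0. pose proof (Rmin_l (r / 2) (Rmin d1 d2)).
    pose proof (Rmin_r (r / 2) (Rmin d1 d2)).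
    pose proof (Rmin_l d1 d2). pose proof (Rmin_r d1 d2). lra. }
  assert (Hr0r : r0 < r) by lra.
  clearbody r0.
  assert (HXd : forall u, Rabs u < r0 -> Rabs (PSeries (PS_incr_1 W) u) < delta).
  { intros u Hu. destruct (HXr u) as [H1 H2]; [lra|]. now apply Rabs_def1. }
  assert (HG : forall u, Rabs u < r0 -> potential g (PSeries (PS_incr_1 W) u) = u ^ 2 / 2).
  { intros u Hu. specialize (HXd u Hu). rewrite HX in *.
    destruct (Himp u) as [H1 H2]; [lra|].
    destruct (potential_PSeries g gs rho (u * PSeries W u) Hcv Hg H1) as [H3 _].
    rewrite H3.
    (* [G x = x^2 (1 + p x) / 2] as power series; at [x = u W u] the implicit equation leaves
       [u^2 / 2]. *)
    rewrite (PSeries_ext _ (PS_incr_n (PS_scal (1/2) (PS_plus PS_one p)) 2)).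
    - rewrite PSeries_incr_n, PSeries_scal, PSeries_plus, PSeries_one.
      + nra.
      + eexists. apply (l1_bound_PSeries rho _ 1); [apply l1_bound_one|lra].
      + eexists. apply (l1_bound_PSeries rho _ _ _ Hp). lra.
    - intros [|[|n]].
      + reflexivity.
      + simpl. unfold zero; simpl. rewrite Hgs0. field.
      + change (gs (S n) / INR (S (S n)) = 1 / 2 * (PS_one n + p n)).
        destruct n as [|n]; [rewrite Hgs1; simpl; field|].
        unfold p, PS_one. field. apply not_0_INR. lia. }
  exists (PS_incr_1 W), r0, delta. split.
  { rewrite <- (Rabs_pos_eq r0) by lra. apply Hcvr. rewrite Rabs_pos_eq; lra. }
  assert (Hder : forall u, Rabs u < r0 ->
    is_derive (PSeries (PS_incr_1 W)) u (PSeries (PS_derive (PS_incr_1 W)) u)).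
  { intros u Hu. apply is_derive_PSeries, Hcvr. lra. }
  assert (HGd : forall x, Rabs x < delta -> is_derive (potential g) x (g x)).
  { intros x Hx. apply (potential_PSeries g gs rho x Hcv Hg). lra. }
  constructor; auto.
  - rewrite HX. ring.
  - intros u Hu. apply continuous_PSeries. rewrite CV_radius_derive. apply Hcvr.
    eapply Rlt_trans; [exact Hu|exact Hr0r].
  - intros u Hu. apply Rlt_le, HD. eapply Rlt_le_trans; [exact Hu|apply Hle].
  - intros u Hu.
    (* Differentiating [G (X v) = v^2 / 2] by the chain rule and directly yields
       [g (X u) * D u = u]. *)
    assert (H1 : is_derive (fun v => potential g (PSeries (PS_incr_1 W) v)) u
      (PSeries (PS_derive (PS_incr_1 W)) u * g (PSeries (PS_incr_1 W) u))).
    { apply (is_derive_comp (potential g) (PSeries (PS_incr_1 W))); auto. }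
    assert (H2 : is_derive (fun v => potential g (PSeries (PS_incr_1 W) v)) u u).
    { apply (is_derive_ext_loc (fun v => v ^ 2 / 2)).
      - apply (filter_imp (fun y => Rabs y < r0)); [|now apply locally_Rabs].
        intros y Hy. symmetry. now apply HG.
      - auto_derive; [exact I|field]. }
    apply is_derive_unique in H1. apply is_derive_unique in H2. lra.
  - intros x y Hx Hy. rewrite !Hg by lra. now apply Hlip.
Qed.

(** * Monotonicity and global inverses *)

Lemma is_derive_continuity_pt (f : R -> R) (x l : R) :
  is_derive f x l -> continuity_pt f x.
Proof.
  intros H. apply continuity_pt_filterlim.
  apply (ex_derive_continuous f). now exists l.
Qed.

Lemma nonincreasing_of_derive (f f' : R -> R) (a b : R) :
  (forall t, is_derive f t (f' t)) -> (forall t, f' t <= 0) -> a <= b -> f b <= f a.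
Proof.
  intros Hd Hn Hab.
  destruct (MVT_gen f a b f') as [c [_ Hc]]; auto.
  { intros; eapply is_derive_continuity_pt; apply Hd. }
  specialize (Hn c). nra.
Qed.

Lemma derive_ge_increment (f f' : R -> R) (m a b : R) :
  (forall t, is_derive f t (f' t)) -> (forall t, m <= f' t) -> a <= b ->
  m * (b - a) <= f b - f a.
Proof.
  intros Hd Hn Hab.
  destruct (MVT_gen f a b f') as [c [_ Hc]]; auto.
  { intros; eapply is_derive_continuity_pt; apply Hd. }
  specialize (Hn c). nra.
Qed.

(** A slope bounded below by [m > 0] makes [f] expand distances by at least [m]: this gives
    surjectivity by intermediate values, injectivity, and a [1/m]-Lipschitz inverse, from which its
    derivative follows. *)
Lemma global_inverse (f f' : R -> R) (m : R) :
  0 < m -> (forall t, is_derive f t (f' t)) -> (forall t, m <= f' t) ->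
  exists h, (forall t, f (h t) = t) /\ (forall x, h (f x) = x) /\
    forall t, is_derive h t (/ f' (h t)).
Proof.
  intros Hm Hd Hf'.
  pose proof (fun a b => derive_ge_increment f f' m a b Hd Hf') as Hinc.
  assert (Hsurj : forall t, exists x, f x = t).
  { intros t.
    (* Over a length [M] the function grows by at least [|t - f 0|], so [t] lies between the values
       of [f] at [- M] and [M]. *)
    set (M := Rabs (t - f 0) / m).
    assert (HM : m * M = Rabs (t - f 0)) by (unfold M; field; lra).
    assert (HM0 : 0 <= M).
    { pose proof (Rabs_pos (t - f 0)). nra. }
    pose proof (Hinc 0 M HM0). assert (Hneg : - M <= 0) by lra.
    pose proof (Hinc (- M) 0 Hneg).
    pose proof (Rle_abs (t - f 0)). pose proof (Rle_abs (- (t - f 0))) as H2.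
    rewrite Rabs_Ropp in H2.
    destruct (IVT_gen f (- M) M t) as [x [_ Hx]].
    - intros x. eapply is_derive_continuity_pt; apply Hd.
    - rewrite Rmin_left, Rmax_right by lra. lra.
    - now exists x. }
  set (h := fun t => proj1_sig (constructive_indefinite_description _ (Hsurj t))).
  assert (Hfh : forall t, f (h t) = t)
    by (intros t; unfold h; now destruct (constructive_indefinite_description _ (Hsurj t))).
  assert (Hlip : forall x y, m * Rabs (x - y) <= Rabs (f x - f y)).
  { intros x y. destruct (Rle_dec y x) as [H|H].
    - specialize (Hinc y x H). rewrite Rabs_pos_eq by lra.
      pose proof (Rle_abs (f x - f y)). lra.
    - assert (H' : x <= y) by lra. specialize (Hinc x y H').
      rewrite Rabs_minus_sym, (Rabs_minus_sym (f x)), Rabs_pos_eq by lra.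
      pose proof (Rle_abs (f y - f x)). lra. }
  exists h. split; [exact Hfh|]. split.
  - intros x. specialize (Hlip (h (f x)) x). rewrite Hfh, Rminus_diag, Rabs_R0 in Hlip.
    pose proof (Rabs_pos (h (f x) - x)).
    assert (H0 : Rabs (h (f x) - x) = 0) by nra.
    apply Rminus_diag_uniq. now apply Rabs_eq_0.
  - intros t. apply is_derive_Reals. intros eps Heps.
    set (x := h t). specialize (Hd x). apply is_derive_Reals in Hd.
    assert (Hp : 0 < f' x) by (specialize (Hf' x); lra).
    (* In the final estimate [m] absorbs the ratio [|e| / |k| <= 1 / m] of increments, and [f' x]
       cancels the factor [/ f' x]. *)
    assert (Heps' : 0 < eps * m * f' x) by (repeat apply Rmult_lt_0_compat; lra).
    destruct (Hd _ Heps') as [d Hdd].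
    pose proof (cond_pos d) as Hdpos.
    assert (Hmd : 0 < m * d) by (apply Rmult_lt_0_compat; lra).
    exists (mkposreal _ Hmd). simpl. intros k Hk Hkd.
    set (e := h (t + k) - x).
    assert (Hfe : f (x + e) - f x = k).
    { unfold e. replace (x + (h (t + k) - x)) with (h (t + k)) by ring.
      unfold x. rewrite !Hfh. ring. }
    assert (He0 : e <> 0).
    { intros H0. rewrite H0, Rplus_0_r in Hfe. lra. }
    assert (Hek : m * Rabs e <= Rabs k).
    { specialize (Hlip (x + e) x). rewrite Hfe in Hlip.
      now replace (x + e - x) with e in Hlip by ring. }
    assert (Hed : Rabs e < d) by nra.
    specialize (Hdd e He0 Hed). rewrite Hfe in Hdd.
    replace (e / k - / f' x) with (- ((k / e - f' x) * (e / k) * / f' x))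
      by (field; repeat split; lra).
    assert (Hek' : Rabs (e / k) = Rabs e / Rabs k).
    { unfold Rdiv. now rewrite Rabs_mult, Rabs_inv. }
    rewrite Rabs_Ropp, !Rabs_mult, Hek', (Rabs_inv (f' x)), (Rabs_pos_eq (f' x)) by lra.
    assert (Hk0 : 0 < Rabs k) by now apply Rabs_pos_lt.
    apply Rmult_lt_reg_r with (f' x * Rabs k); [now apply Rmult_lt_0_compat|].
    replace (Rabs (k / e - f' x) * (Rabs e / Rabs k) * / f' x * (f' x * Rabs k))
      with (Rabs (k / e - f' x) * Rabs e) by (field; lra).
    pose proof (Rabs_pos_lt e He0).
    apply Rlt_le_trans with (eps * m * f' x * Rabs e).
    + now apply Rmult_lt_compat_r.
    + replace (eps * m * f' x * Rabs e) with (eps * f' x * (m * Rabs e)) by ring.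
      rewrite <- (Rmult_assoc eps). apply Rmult_le_compat_l; [|exact Hek].
      apply Rlt_le, Rmult_lt_0_compat; lra.
Qed.

(** * Angles *)

Lemma polar_coordinates (u v r : R) :
  0 < r -> u ^ 2 + v ^ 2 = r ^ 2 -> exists phi, u = r * sin phi /\ v = r * cos phi.
Proof.
  intros Hr H.
  assert (Hv : -1 <= v / r <= 1).
  { split; apply Rmult_le_reg_r with r; auto; unfold Rdiv;
      rewrite Rmult_assoc, Rinv_l by lra; nra. }
  assert (Hu : sqrt (1 - (v / r)²) = Rabs u / r).
  { replace (1 - (v / r)²) with ((Rabs u / r)²).
    - apply sqrt_Rsqr. apply Rdiv_le_0_compat; [apply Rabs_pos|exact Hr].
    - unfold Rsqr, Rdiv.
      replace (Rabs u * / r * (Rabs u * / r)) with (Rabs u ^ 2 / r ^ 2) by (field; lra).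
      rewrite pow2_abs. apply Rmult_eq_reg_r with (r ^ 2); [|apply pow_nonzero; lra].
      field_simplify; lra. }
  destruct (Rle_dec 0 u) as [Hs|Hs].
  - exists (acos (v / r)). rewrite cos_acos, sin_acos, Hu by exact Hv.
    rewrite Rabs_pos_eq by exact Hs. split; field; lra.
  - exists (- acos (v / r)). rewrite cos_neg, sin_neg, cos_acos, sin_acos, Hu by exact Hv.
    rewrite Rabs_left by lra. split; field; lra.
Qed.

(** The hypotheses give [cos (b - a) = 1], so [sin ((b - a) / 2) = 0]; this is impossible while the
    half difference lies strictly between [0] and [PI]. *)
Lemma same_angle (a b : R) :
  cos a = cos b -> sin a = sin b -> a < b -> a + 2 * PI <= b.
Proof.
  intros Hc Hs Hab. apply Rnot_lt_le. intros Hlt.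
  assert (H1 : cos (b - a) = 1).
  { rewrite cos_minus, Hc, Hs. pose proof (sin2_cos2 b) as H. unfold Rsqr in H. lra. }
  replace (b - a) with (2 * ((b - a) / 2)) in H1 by field.
  rewrite cos_2a_sin in H1.
  assert (0 < sin ((b - a) / 2)) by (apply sin_gt_0; lra). nra.
Qed.

(** * Uniqueness of solutions *)

(** Gronwall's argument for the squared distance [N], which satisfies [|N'| <= 3 N] and starts at
    [0]. *)
Lemma solution_unique (g x1 y1 x2 y2 : R -> R) (delta : R) :
  (forall x y, Rabs x < delta -> Rabs y < delta -> Rabs (g x - g y) <= 2 * Rabs (x - y)) ->
  solution g x1 y1 -> solution g x2 y2 ->
  (forall t, Rabs (x1 t) < delta) -> (forall t, Rabs (x2 t) < delta) ->
  x1 0 = x2 0 -> y1 0 = y2 0 -> forall t, x1 t = x2 t /\ y1 t = y2 t.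
Proof.
  intros Hlip S1 S2 B1 B2 Hx Hy.
  set (N := fun t => (x1 t - x2 t) ^ 2 + (y1 t - y2 t) ^ 2).
  set (N' := fun t => 2 * (x1 t - x2 t) * (y1 t - y2 t) +
    2 * (y1 t - y2 t) * (- g (x1 t) - - g (x2 t))).
  assert (HN : forall t, is_derive N t (N' t)).
  { intros t. unfold N, N'. destruct (S1 t) as [H1 H2]. destruct (S2 t) as [H3 H4].
    auto_derive.
    - repeat split; auto; eexists; eassumption.
    - rewrite (is_derive_unique (fun s : R => x1 s) _ _ H1), (is_derive_unique (fun s : R => y1 s) _ _ H2),
        (is_derive_unique (fun s : R => x2 s) _ _ H3), (is_derive_unique (fun s : R => y2 s) _ _ H4). ring. }
  assert (Hb : forall t, Rabs (N' t) <= 3 * N t).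
  { intros t. unfold N, N'. specialize (Hlip _ _ (B1 t) (B2 t)).
    replace (2 * (x1 t - x2 t) * (y1 t - y2 t) + 2 * (y1 t - y2 t) * (- g (x1 t) - - g (x2 t)))
      with (2 * (y1 t - y2 t) * ((x1 t - x2 t) - (g (x1 t) - g (x2 t)))) by ring.
    rewrite !Rabs_mult, (Rabs_pos_eq 2) by lra.
    rewrite <- (pow2_abs (x1 t - x2 t)), <- (pow2_abs (y1 t - y2 t)).
    pose proof (Rabs_triang (x1 t - x2 t) (- (g (x1 t) - g (x2 t)))) as Ht.
    rewrite Rabs_Ropp in Ht.
    pose proof (Rabs_pos (y1 t - y2 t)). pose proof (Rabs_pos (x1 t - x2 t)).
    set (p := Rabs (y1 t - y2 t)) in *. set (q := Rabs (x1 t - x2 t)) in *.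
    set (s := Rabs (x1 t - x2 t - (g (x1 t) - g (x2 t)))) in *.
    assert (s <= 3 * q) by (unfold s, Rminus; unfold Rminus in Ht, Hlip; lra).
    assert (2 * p * s <= 2 * p * (3 * q)) by (apply Rmult_le_compat_l; lra).
    pose proof (pow2_ge_0 (p - q)). nra. }
  assert (HNpos : forall t, 0 <= N t) by (intros; unfold N; apply Rplus_le_le_0_compat; apply pow2_ge_0).
  assert (HN0 : N 0 = 0) by (unfold N; rewrite Hx, Hy; ring).
  assert (HNz : forall t, N t <= 0).
  (* Forward in time [exp (-3 t) * N t] is nonincreasing; backward, [exp (3 t) * N t] is
     nondecreasing and reaches [0] at time [0]. *)
  { intros t. destruct (Rle_dec 0 t) as [Ht|Ht].
    - pose proof (nonincreasing_of_derive (fun t => exp (- 3 * t) * N t)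
        (fun t => exp (- 3 * t) * (N' t - 3 * N t)) 0 t) as H.
      simpl in H. rewrite HN0 in H.
      assert (exp (-3 * t) * N t <= 0).
      { rewrite <- (Rmult_0_r (exp (-3 * 0))). apply H; [| |exact Ht].
        - intros s. auto_derive; [eexists; apply HN|].
          rewrite (is_derive_unique (fun s : R => N s) _ _ (HN s)). ring.
        - intros s. pose proof (exp_pos (-3 * s)). specialize (Hb s).
          pose proof (Rle_abs (N' s)). nra. }
      pose proof (exp_pos (-3 * t)). nra.
    - pose proof (nonincreasing_of_derive (fun t => - (exp (3 * t) * N t))
        (fun t => - (exp (3 * t) * (N' t + 3 * N t))) t 0) as H.
      simpl in H. rewrite HN0 in H.
      assert (- (exp (3 * 0) * 0) <= - (exp (3 * t) * N t)).
      { apply H; [| |lra].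
        - intros s. auto_derive; [eexists; apply HN|].
          rewrite (is_derive_unique (fun s : R => N s) _ _ (HN s)). ring.
        - intros s. pose proof (exp_pos (3 * s)). specialize (Hb s).
          pose proof (Rle_abs (- N' s)) as H2. rewrite Rabs_Ropp in H2. nra. }
      pose proof (exp_pos (3 * t)). nra. }
  intros t. specialize (HNz t). unfold N in HNz.
  pose proof (pow2_ge_0 (x1 t - x2 t)) as P1. pose proof (pow2_ge_0 (y1 t - y2 t)) as P2.
  split; apply Rminus_diag_uniq, Rsqr_0_uniq; rewrite Rsqr_pow2; lra.
Qed.

(** * Orbits in the energy coordinate *)

(* Along [x = X (r sin theta)], [y = r cos theta] time is [period_map D r theta]. *)
Definition period_map (D : R -> R) (r theta : R) : R :=
  RInt (fun s => D (r * sin s)) 0 theta.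

Lemma Rabs_mult_sin_le (r s : R) : Rabs (r * sin s) <= Rabs r.
Proof.
  rewrite Rabs_mult. rewrite <- (Rmult_1_r (Rabs r)) at 2.
  apply Rmult_le_compat_l; [apply Rabs_pos|]. apply Rabs_le, SIN_bound.
Qed.

Section Chart.

Context {g X D : R -> R} {r0 delta : R} (chart : energy_chart g X D r0 delta).

Lemma chart_increasing (u v : R) : Rabs u < r0 -> Rabs v < r0 -> u < v -> X u < X v.
Proof.
  intros Hu Hv Huv.
  assert (Hin : forall z, u <= z <= v -> Rabs z < r0).
  { intros z Hz. apply Rabs_def2 in Hu. apply Rabs_def2 in Hv. apply Rabs_def1; lra. }
  destruct (MVT_gen X u v D) as [c [Hc H]].
  - rewrite Rmin_left, Rmax_right by lra. intros z Hz. apply (chart_derive chart), Hin. lra.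
  - rewrite Rmin_left, Rmax_right by lra. intros z Hz.
    eapply is_derive_continuity_pt, (chart_derive chart), Hin, Hz.
  - rewrite Rmin_left, Rmax_right in Hc by lra.
    pose proof (chart_D_ge chart c (Hin c Hc)). nra.
Qed.

Lemma chart_injective (u v : R) : Rabs u < r0 -> Rabs v < r0 -> X u = X v -> u = v.
Proof.
  intros Hu Hv H. destruct (Rtotal_order u v) as [Hl|[He|Hg]]; [|exact He|].
  - pose proof (chart_increasing u v Hu Hv Hl). lra.
  - pose proof (chart_increasing v u Hv Hu Hg). lra.
Qed.

Lemma chart_sin_in (r s : R) : Rabs r < r0 -> Rabs (r * sin s) < r0.
Proof. intros H. pose proof (Rabs_mult_sin_le r s). lra. Qed.

Lemma continuous_chart_sin (r s : R) :
  Rabs r < r0 -> continuous (fun s => D (r * sin s)) s.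
Proof.
  intros Hr. apply (continuous_comp (fun s => r * sin s) D).
  - apply (ex_derive_continuous (fun s => r * sin s)). auto_derive. exact I.
  - now apply (chart_continuous chart), chart_sin_in.
Qed.

Lemma ex_RInt_chart_sin (r a b : R) :
  Rabs r < r0 -> ex_RInt (fun s => D (r * sin s)) a b.
Proof.
  intros Hr. apply (@ex_RInt_continuous R_CompleteNormedModule).
  intros z _. now apply continuous_chart_sin.
Qed.

Lemma is_derive_period_map (r theta : R) :
  Rabs r < r0 -> is_derive (period_map D r) theta (D (r * sin theta)).
Proof.
  intros Hr. apply (is_derive_RInt (fun s => D (r * sin s)) _ 0).
  - apply filter_forall. intros b. now apply (@RInt_correct R_CompleteNormedModule), ex_RInt_chart_sin.
  - now apply continuous_chart_sin.
Qed.

Lemma period_map_increment (r a b : R) :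
  Rabs r < r0 -> a <= b -> 1 / 2 * (b - a) <= period_map D r b - period_map D r a.
Proof.
  intros Hr. apply derive_ge_increment with (fun theta => D (r * sin theta)).
  - intros t. now apply is_derive_period_map.
  - intros t. now apply (chart_D_ge chart), chart_sin_in.
Qed.

(** The integrand is [2 PI]-periodic, so the time taken by a full turn starting at [theta] has zero
    derivative in [theta]. *)
Lemma period_map_shift (r theta : R) :
  Rabs r < r0 ->
  period_map D r (theta + 2 * PI) = period_map D r theta + period_map D r (2 * PI).
Proof.
  intros Hr.
  set (f := fun t => period_map D r (t + 2 * PI) - period_map D r t).
  assert (Hf : forall t, is_derive f t 0).
  { intros t. unfold f.
    replace 0 with (1 * D (r * sin (t + 2 * PI)) - D (r * sin t)).
    - apply (is_derive_minus (fun t => period_map D r (t + 2 * PI)) (period_map D r)).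
      + apply (is_derive_comp (period_map D r) (fun t => t + 2 * PI)).
        * now apply is_derive_period_map.
        * auto_derive; [exact I|ring].
      + now apply is_derive_period_map.
    - replace (sin (t + 2 * PI)) with (sin t); [ring|].
      rewrite sin_plus, cos_2PI, sin_2PI. ring. }
  assert (Hc : f theta = f 0).
  { destruct (MVT_gen f 0 theta (fun _ => 0)) as [c [_ H]]; auto.
    - intros; eapply is_derive_continuity_pt; apply Hf.
    - lra. }
  unfold f in Hc. rewrite Rplus_0_l in Hc.
  assert (H0 : period_map D r 0 = 0) by (unfold period_map; apply (@RInt_point R_CompleteNormedModule)).
  lra.
Qed.

(** The inverse [h] of the time function [tau] gives the angle as a function of time, with
    [h' = 1 / D]. Then [x' = D * r cos h / D = y], and [y' = - u / D = - g (X u)] by the force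
    relation. The offset [t0] places the starting angle at [phi]. *)
Lemma chart_orbit (r phi : R) :
  0 < r < r0 ->
  exists x y, periodic_orbit g x y /\ x 0 = X (r * sin phi) /\ y 0 = r * cos phi /\
    (forall t, exists psi, x t = X (r * sin psi) /\ y t = r * cos psi) /\
    minimal_period x y (period_map D r (2 * PI)).
Proof.
  intros [Hr Hr0].
  assert (Hra : Rabs r < r0) by (rewrite Rabs_pos_eq; lra).
  set (tau := period_map D r).
  destruct (global_inverse tau (fun theta => D (r * sin theta)) (1 / 2)) as [h [Hth [Hht Hdh]]].
  { lra. }
  { intros t. now apply is_derive_period_map. }
  { intros t. now apply (chart_D_ge chart), chart_sin_in. }
  set (t0 := tau phi). set (T := tau (2 * PI)).
  set (x := fun t => X (r * sin (h (t + t0)))).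
  set (y := fun t => r * cos (h (t + t0))).
  assert (Hinc : forall a b, a <= b -> 1 / 2 * (b - a) <= tau b - tau a)
    by (intros; now apply period_map_increment).
  assert (Hmon : forall s t, s < t -> h s < h t).
  { intros s t Hst. apply Rnot_le_lt. intros H. apply Hinc in H as H'. rewrite !Hth in H'. lra. }
  assert (Hshift : forall t, h (t + T) = h t + 2 * PI).
  { intros t. rewrite <- (Hht (h t + 2 * PI)). f_equal.
    unfold tau. rewrite period_map_shift by exact Hra. fold tau. now rewrite Hth. }
  assert (HT : 0 < T).
  { pose proof PI_RGT_0. assert (H0 : 0 <= 2 * PI) by lra. specialize (Hinc 0 (2 * PI) H0).
    replace (tau 0) with 0 in Hinc; [unfold T; lra|].
    symmetry. apply (@RInt_point R_CompleteNormedModule). }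
  assert (Hdh' : forall t, is_derive (fun t => h (t + t0)) t (/ D (r * sin (h (t + t0))))).
  { intros t. replace (/ D (r * sin (h (t + t0)))) with (1 * / D (r * sin (h (t + t0)))) by ring.
    apply (is_derive_comp h (fun t => t + t0)); [apply Hdh|].
    auto_derive; [exact I|ring]. }
  assert (Hsol : solution g x y).
  { intros t. set (th := h (t + t0)).
    assert (Hin : Rabs (r * sin th) < r0) by now apply chart_sin_in.
    pose proof (chart_D_ge chart _ Hin) as HD.
    pose proof (chart_force chart _ Hin) as HF.
    specialize (Hdh' t). fold th in Hdh'.
    split.
    - replace (y t) with (r * (/ D (r * sin th) * cos th) * D (r * sin th))
        by (unfold y; fold th; field; lra).
      unfold x. apply (is_derive_comp X (fun t => r * sin (h (t + t0)))).
      + now apply (chart_derive chart).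
      + apply (is_derive_scal (fun t => sin (h (t + t0)))).
        apply (is_derive_comp sin (fun t => h (t + t0)));
          [apply is_derive_Reals, derivable_pt_lim_sin|exact Hdh'].
    - replace (- g (x t)) with (r * (/ D (r * sin th) * - sin th)).
      + unfold y. apply (is_derive_scal (fun t => cos (h (t + t0)))).
        apply (is_derive_comp cos (fun t => h (t + t0)));
          [apply is_derive_Reals, derivable_pt_lim_cos|exact Hdh'].
      + unfold x. fold th. apply Rmult_eq_reg_r with (D (r * sin th)); [|lra].
        replace (- g (X (r * sin th)) * D (r * sin th)) with (- (r * sin th)) by lra.
        field; lra. }
  assert (Hper : is_period x y T).
  { split; [exact HT|]. intros t. unfold x, y.
    replace (t + T + t0) with (t + t0 + T) by ring. rewrite Hshift.
    rewrite sin_plus, cos_plus, cos_2PI, sin_2PI. split; [f_equal|]; ring. }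
  exists x, y. split; [split; [exact Hsol|split; [now exists T|]]|].
  (* Half a turn later both [u] and [y] have changed sign, and they are not both zero; so the orbit
     is not constant. *)
  { exists (tau (phi + PI) - t0). unfold x, y. rewrite Rplus_0_l.
    replace (tau (phi + PI) - t0 + t0) with (tau (phi + PI)) by ring.
    unfold t0. rewrite !Hht, neg_cos, neg_sin. intros E. injection E as E1 E2.
    apply chart_injective in E1; [|rewrite <- neg_sin; now apply chart_sin_in|now apply chart_sin_in].
    assert (Hs : sin phi = 0) by nra. assert (Hc : cos phi = 0) by nra.
    pose proof (sin2_cos2 phi) as H. unfold Rsqr in H. nra. }
  split; [unfold x, t0; now rewrite Rplus_0_l, Hht|].
  split; [unfold y, t0; now rewrite Rplus_0_l, Hht|].
  split; [intros t; now exists (h (t + t0))|].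
  split; [exact Hper|].
  (* After a period [S] the angle has strictly increased with the same sine and cosine, hence by at
     least [2 PI]; monotonicity of [tau] turns this into [T <= S]. *)
  intros S [HS HSp]. fold tau T. destruct (HSp 0) as [E1 E2].
  unfold x in E1. unfold y in E2. rewrite !Rplus_0_l in *.
  apply chart_injective in E1; [|now apply chart_sin_in|now apply chart_sin_in].
  assert (Hlt : h t0 < h (S + t0)) by (apply Hmon; lra).
  apply Rmult_eq_reg_l in E1; [|lra]. apply Rmult_eq_reg_l in E2; [|lra].
  pose proof (same_angle _ _ (eq_sym E2) (eq_sym E1) Hlt) as Ha.
  rewrite <- Hshift in Ha. specialize (Hinc _ _ Ha). rewrite !Hth in Hinc.
  lra.
Qed.

End Chart.

(** * Energy discs and the isochrony criterion *)

Lemma minimal_period_unique (x y : R -> R) (S T : R) :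
  minimal_period x y S -> minimal_period x y T -> S = T.
Proof. intros [H1 H2] [H3 H4]. apply Rle_antisym; auto. Qed.

Lemma minimal_period_ext (x y x' y' : R -> R) (T : R) :
  (forall t, x t = x' t /\ y t = y' t) -> minimal_period x' y' T -> minimal_period x y T.
Proof.
  intros H [[HT Hp] Hm].
  assert (Hx : forall t, x t = x' t) by apply H. assert (Hy : forall t, y t = y' t) by apply H.
  split.
  - split; [exact HT|]. intros t. now rewrite !Hx, !Hy.
  - intros S [HS HSp]. apply Hm. split; [exact HS|].
    intros t. now rewrite <- !Hx, <- !Hy.
Qed.

(* The disc of radius [rho] in the coordinates [(u, y)], where [x = X u]. *)
Definition energy_disc (g X : R -> R) (rho : R) (p : R * R) : Prop :=
  X (- rho) < fst p < X rho /\ snd p ^ 2 + 2 * potential g (fst p) < rho ^ 2.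

Section Orbits.

Context {g X D : R -> R} {r0 delta : R} (chart : energy_chart g X D r0 delta).

Lemma chart_preimage (rho x : R) :
  0 < rho < r0 -> X (- rho) < x < X rho -> exists u, Rabs u <= rho /\ x = X u.
Proof.
  intros Hrho Hx.
  destruct (f_interv_is_interv X (- rho) rho x) as [u [Hu1 Hu2]]; [lra|lra| |].
  - intros z Hz. eapply is_derive_continuity_pt, (chart_derive chart).
    apply Rle_lt_trans with rho; [apply Rabs_le; lra|lra].
  - exists u. split; [apply Rabs_le; lra|now symmetry].
Qed.

Lemma chart_straddles_0 (rho : R) : 0 < rho < r0 -> X (- rho) < 0 < X rho.
Proof.
  intros H. rewrite <- (chart_0 chart) at 1 2.
  assert (Rabs 0 < r0) by (rewrite Rabs_R0; lra).
  assert (Rabs rho < r0) by (rewrite Rabs_pos_eq; lra).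
  split; apply (chart_increasing chart); rewrite ?Rabs_Ropp; auto; lra.
Qed.

Lemma energy_disc_open (rho : R) : 0 < rho < r0 -> open (energy_disc g X rho).
Proof.
  intros Hrho p [H1 H2].
  destruct (chart_preimage rho (fst p) Hrho H1) as [u [Hu Hpu]].
  assert (Hd : Rabs (fst p) < delta)
    by (rewrite Hpu; apply (chart_range chart); lra).
  apply filter_and.
  - destruct p as [px py].
    apply (continuous_fst px py (fun z => X (- rho) < z < X rho)). now apply locally_between.
  - assert (Hc : continuous (fun q : R * R => plus (mult (snd q) (snd q))
      (mult 2 (potential g (fst q)))) p).
    { apply (continuous_plus (fun q : R * R => mult (snd q) (snd q))).
      - apply (continuous_mult (fun q : R * R => snd q) (fun q : R * R => snd q));
          destruct p; apply continuous_snd.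
      - apply (continuous_mult (fun _ : R * R => 2)); [apply continuous_const|].
        apply (continuous_comp (fun q : R * R => fst q) (potential g)).
        + destruct p; apply continuous_fst.
        + apply (ex_derive_continuous (potential g)). eexists.
          now apply (chart_derive_potential chart). }
    assert (Hlt : locally (plus (mult (snd p) (snd p)) (mult 2 (potential g (fst p))))
      (fun z : R => z < rho ^ 2)).
    { apply (open_lt (rho ^ 2)). unfold plus, mult; simpl. simpl in H2. lra. }
    specialize (Hc _ Hlt). unfold filtermap in Hc. revert Hc. apply filter_imp.
    intros q Hq. unfold plus, mult in Hq; simpl in Hq. simpl. lra.
Qed.

Lemma energy_disc_0 (rho : R) : 0 < rho < r0 -> energy_disc g X rho (0, 0).
Proof.
  intros Hrho. split; [now apply chart_straddles_0|]. simpl.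
  assert (HR : Rabs 0 < r0) by (rewrite Rabs_R0; lra).
  pose proof (chart_potential chart 0 HR) as H.
  rewrite (chart_0 chart) in H. rewrite H. nra.
Qed.

Lemma energy_disc_polar (rho : R) (p : R * R) :
  0 < rho < r0 -> energy_disc g X rho p -> p <> (0, 0) ->
  exists r phi, 0 < r < rho /\ p = (X (r * sin phi), r * cos phi).
Proof.
  intros Hrho [H1 H2] Hp. destruct p as [x y]; simpl fst in *; simpl snd in *.
  destruct (chart_preimage rho x Hrho H1) as [u [Hu ->]].
  rewrite (chart_potential chart) in H2 by lra.
  assert (Hs : 0 < u ^ 2 + y ^ 2).
  { apply Rnot_le_lt. intros Hle. apply Hp.
    pose proof (pow2_ge_0 u). pose proof (pow2_ge_0 y).
    assert (u = 0) by (apply Rsqr_0_uniq; rewrite Rsqr_pow2; lra).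
    assert (y = 0) by (apply Rsqr_0_uniq; rewrite Rsqr_pow2; lra).
    subst. now rewrite (chart_0 chart). }
  set (r := sqrt (u ^ 2 + y ^ 2)).
  assert (Hr : 0 < r) by now apply sqrt_lt_R0.
  assert (Hr2 : u ^ 2 + y ^ 2 = r ^ 2) by (unfold r; rewrite pow2_sqrt; lra).
  destruct (polar_coordinates u y r Hr Hr2) as [phi [Eu Ey]].
  exists r, phi. rewrite <- Eu, <- Ey. split; [|reflexivity]. split; [exact Hr|]. nra.
Qed.

Lemma polar_energy_disc (rho r psi : R) :
  0 < r < rho -> rho < r0 ->
  energy_disc g X rho (X (r * sin psi), r * cos psi) /\
  (X (r * sin psi), r * cos psi) <> (0, 0).
Proof.
  intros Hr Hrho.
  assert (Hra : Rabs r < r0) by (rewrite Rabs_pos_eq; lra).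
  pose proof (chart_sin_in r psi Hra) as Hin.
  pose proof (Rabs_mult_sin_le r psi) as Hle. rewrite (Rabs_pos_eq r) in Hle by lra.
  pose proof (sin2_cos2 psi) as Hsc. unfold Rsqr in Hsc.
  split; [split|].
  - simpl. apply Rabs_def2 in Hin as Hin'. apply Rabs_le_between in Hle.
    assert (Rabs rho < r0) by (rewrite Rabs_pos_eq; lra).
    split; apply (chart_increasing chart); rewrite ?Rabs_Ropp; auto; lra.
  - simpl fst; simpl snd. rewrite (chart_potential chart) by exact Hin.
    replace ((r * cos psi) ^ 2 + 2 * ((r * sin psi) ^ 2 / 2)) with
      (r ^ 2 * (sin psi * sin psi + cos psi * cos psi)) by field.
    rewrite Hsc. nra.
  - intros E. injection E as E1 E2. rewrite <- (chart_0 chart) in E1.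
    apply (chart_injective chart) in E1; [|exact Hin|rewrite Rabs_R0; lra].
    assert (Hs : sin psi = 0) by nra. assert (Hc : cos psi = 0) by nra.
    rewrite Hs, Hc in Hsc. lra.
Qed.

Lemma chart_center : center_at_origin g.
Proof.
  pose proof (chart_radius chart) as Hr0.
  set (rho := r0 / 2). assert (Hrho : 0 < rho < r0) by (unfold rho; lra).
  exists (energy_disc g X rho).
  split; [now apply energy_disc_open|]. split; [now apply energy_disc_0|].
  intros p Hp Hp0.
  destruct (energy_disc_polar rho p Hrho Hp Hp0) as [r [phi [Hr ->]]].
  destruct (chart_orbit chart r phi) as [x [y [H1 [H2 [H3 [H4 _]]]]]]; [lra|].
  exists x, y. split; [exact H1|]. split; [now rewrite H2, H3|].
  intros t. destruct (H4 t) as [psi [-> ->]]. apply polar_energy_disc; lra.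
Qed.

(** The starting point has polar coordinates [r], [phi], and uniqueness identifies the given orbit
    with the chart orbit through that point, whose minimal period is known. *)
Lemma periodic_orbit_in_disc (rho : R) (x y : R -> R) :
  0 < rho < r0 -> periodic_orbit g x y ->
  (forall t, energy_disc g X rho (x t, y t)) ->
  exists r, 0 < r < rho /\ minimal_period x y (period_map D r (2 * PI)).
Proof.
  intros Hrho [Hsol [_ [t1 Ht1]]] Hin.
  assert (Hxd : forall t, Rabs (x t) < delta).
  { intros t. destruct (Hin t) as [H _].
    destruct (chart_preimage rho (x t) Hrho H) as [u [Hu ->]].
    apply (chart_range chart). lra. }
  (* Starting at the origin, the solution would be the equilibrium by uniqueness, against
     nonconstancy. *)
  assert (Hp : (x 0, y 0) <> (0, 0)).
  { intros E. apply Ht1. rewrite E. injection E as E1 E2.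
    assert (R0 : Rabs 0 < r0) by (rewrite Rabs_R0; lra).
    assert (Hg0 : g 0 = 0).
    { pose proof (chart_force chart 0 R0) as H.
      rewrite (chart_0 chart), (chart_D0 chart) in H. lra. }
    destruct (solution_unique g x y (fun _ => 0) (fun _ => 0) delta) with (t := t1)
      as [H1 H2]; auto.
    - apply (chart_lipschitz chart).
    - intros t. rewrite Hg0, Ropp_0. split; now auto_derive.
    - intros t. pose proof (chart_range chart 0 R0) as H.
      now rewrite (chart_0 chart) in H.
    - now rewrite H1, H2. }
  destruct (energy_disc_polar rho _ Hrho (Hin 0) Hp) as [r [phi [Hr E]]].
  injection E as E1 E2.
  destruct (chart_orbit chart r phi) as [x' [y' [H1 [H2 [H3 [H4 H5]]]]]]; [lra|].
  exists r. split; [exact Hr|]. apply minimal_period_ext with x' y'; [|exact H5].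
  apply (solution_unique g x y x' y' delta); auto.
  - apply (chart_lipschitz chart).
  - apply H1.
  - intros t. destruct (H4 t) as [psi [-> _]].
    apply (chart_range chart), chart_sin_in. rewrite Rabs_pos_eq; lra.
  - now rewrite E1.
  - now rewrite E2.
Qed.

(** Chart orbits of small radius lie in any prescribed neighbourhood of the origin; conversely every
    periodic orbit inside an energy disc has the period of a chart orbit, so that disc serves as the
    neighbourhood. *)
Lemma isochronous_iff_period_constant :
  isochronous_center_at_origin g <->
  exists T rho, 0 < rho < r0 /\
    forall r, 0 < r < rho -> period_map D r (2 * PI) = T.
Proof.
  pose proof (chart_radius chart) as Hr0.
  split.
  - intros [_ [T [U [HU [HU0 HT]]]]].
    destruct (HU _ HU0) as [eps Heps]. pose proof (cond_pos eps) as He.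
    assert (HR0 : Rabs 0 < r0) by (rewrite Rabs_R0; lra).
    destruct (continuous_pos_ball X (fun z => - eps < z < eps)) as [d [Hd HX]].
    { apply (ex_derive_continuous X). eexists. now apply (chart_derive chart). }
    { apply locally_between. rewrite (chart_0 chart). lra. }
    (* [d] keeps [x = X (r sin psi)] within [eps], and [eps] does the same for [y = r cos psi]. *)
    set (rho := Rmin (r0 / 2) (Rmin d eps)).
    assert (Hle : 0 < rho /\ rho <= r0 / 2 /\ rho <= d /\ rho <= eps).
    { unfold rho. pose proof (Rmin_l (r0 / 2) (Rmin d eps)).
      pose proof (Rmin_r (r0 / 2) (Rmin d eps)).
      pose proof (Rmin_l d eps). pose proof (Rmin_r d eps).
      repeat split; try lra. repeat apply Rmin_pos; lra. }
    clearbody rho.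
    exists T, rho. split; [lra|]. intros r Hr.
    destruct (chart_orbit chart r 0) as [x [y [H1 [_ [_ [H4 H5]]]]]]; [lra|].
    apply (minimal_period_unique x y); [exact H5|]. apply HT; [exact H1|].
    intros t. apply Heps. destruct (H4 t) as [psi [-> ->]].
    pose proof (Rabs_mult_sin_le r psi) as Hs. rewrite (Rabs_pos_eq r) in Hs by lra.
    assert (Hc : Rabs (r * cos psi) <= r).
    { rewrite Rabs_mult, (Rabs_pos_eq r) by lra.
      rewrite <- (Rmult_1_r r) at 2. apply Rmult_le_compat_l; [lra|].
      apply Rabs_le, COS_bound. }
    assert (Hd' : Rabs (r * sin psi) < d) by lra.
    destruct (HX _ Hd') as [H6 H7].
    split; simpl; unfold ball; simpl; unfold AbsRing_ball, abs, minus, plus, opp; simpl;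
      rewrite Ropp_0, Rplus_0_r.
    + now apply Rabs_def1.
    + lra.
  - intros [T [rho [Hrho HT]]]. split; [exact chart_center|].
    exists T, (energy_disc g X rho).
    split; [now apply energy_disc_open|]. split; [now apply energy_disc_0|].
    intros x y Hxy Hin.
    destruct (periodic_orbit_in_disc rho x y Hrho Hxy Hin) as [r [Hr Hm]].
    now rewrite HT in Hm.
Qed.

(** * The period and the even part of the derivative *)

Lemma continuous_chart_even_sin (r s : R) :
  Rabs r < r0 -> continuous (fun s => D (r * sin s) + D (- (r * sin s))) s.
Proof.
  intros Hr. apply (continuous_plus (fun s => D (r * sin s)) (fun s => D (- (r * sin s)))).
  - now apply (continuous_chart_sin chart).
  - apply (continuous_ext (fun s => D (- r * sin s))); [intros; f_equal; ring|].
    apply (continuous_chart_sin chart). now rewrite Rabs_Ropp.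
Qed.

(** Shifting the second half turn by [PI] changes the sign of the sine, which folds the integrand
    into twice the even part of [D]. *)
Lemma period_map_half (r : R) :
  Rabs r < r0 ->
  period_map D r (2 * PI) = RInt (fun s => D (r * sin s) + D (- (r * sin s))) 0 PI.
Proof.
  intros Hr. unfold period_map.
  pose proof (fun a b => ex_RInt_chart_sin chart r a b Hr) as Hex.
  rewrite <- (RInt_Chasles _ 0 PI (2 * PI)) by apply Hex.
  assert (E : RInt (fun s => D (r * sin s)) PI (2 * PI) = RInt (fun s => D (- (r * sin s))) 0 PI).
  { replace PI with (1 * 0 + PI) at 1 by ring. replace (2 * PI) with (1 * PI + PI) by ring.
    rewrite <- (RInt_comp_lin (fun s => D (r * sin s))) by apply Hex.
    apply RInt_ext. intros s _. unfold scal; simpl; unfold mult; simpl.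
    rewrite !Rmult_1_l, neg_sin. f_equal. ring. }
  rewrite E. symmetry. apply (RInt_plus (V := R_CompleteNormedModule)).
  - apply Hex.
  - apply (ex_RInt_ext (fun s => D (- r * sin s))); [intros; f_equal; ring|].
    apply (ex_RInt_chart_sin chart). now rewrite Rabs_Ropp.
Qed.

Lemma period_of_even_part (rho r : R) :
  rho < r0 -> (forall u, 0 < u < rho -> D u + D (- u) = 2) ->
  0 < r < rho -> period_map D r (2 * PI) = 2 * PI.
Proof.
  intros Hrho HD Hr.
  rewrite period_map_half by (rewrite Rabs_pos_eq; lra).
  rewrite (RInt_ext _ (fun _ => 2)).
  - rewrite RInt_const. unfold scal; simpl; unfold mult; simpl. ring.
  - pose proof PI_RGT_0. rewrite Rmin_left, Rmax_right by lra. intros s Hs.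
    assert (0 < sin s) by (apply sin_gt_0; lra).
    pose proof (SIN_bound s). apply HD. split; [now apply Rmult_lt_0_compat|nra].
Qed.

(** Mean value theorem for integrals on [[0, PI]]: the integrand takes its mean [T / PI] at an
    interior [c], and [u = r sin c] is positive there. Small [r] thus give arbitrarily small such
    [u]. *)
Lemma period_constant_zero (T r : R) :
  0 < r < r0 -> period_map D r (2 * PI) = T ->
  exists u, 0 < u <= r /\ D u + D (- u) = T / PI.
Proof.
  intros Hr HT. pose proof PI_RGT_0 as HPI.
  assert (Hra : Rabs r < r0) by (rewrite Rabs_pos_eq; lra).
  rewrite period_map_half in HT by exact Hra.
  set (e := fun s => D (r * sin s) + D (- (r * sin s))) in HT.
  assert (He : forall s, continuous e s) by (intros; now apply continuous_chart_even_sin).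
  destruct (MVT_cor2 (fun t => RInt e 0 t) e 0 PI HPI) as [c [Hc1 Hc2]].
  - intros s _. apply is_derive_Reals. apply (is_derive_RInt e _ 0); [|apply He].
    apply filter_forall. intros b. apply (@RInt_correct R_CompleteNormedModule).
    apply (@ex_RInt_continuous R_CompleteNormedModule). intros; apply He.
  - exists (r * sin c).
    assert (0 < sin c) by (apply sin_gt_0; lra). pose proof (SIN_bound c).
    split; [split; [apply Rmult_lt_0_compat; lra|nra]|].
    rewrite HT in Hc1. replace (RInt e 0 0) with 0 in Hc1
      by (symmetry; apply (@RInt_point R_CompleteNormedModule)).
    change (e c = T / PI). field_simplify in Hc1. rewrite Hc1. field. lra.
Qed.

End Orbits.

(** * Zeros and parity of power series *)

(** Continuity at [0] forces [e 0 = 0]; dividing by [u] then turns small positive zeros into zeros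
    of the shifted series, and induction continues. *)
Lemma PSeries_accumulating_zeros (n : nat) (e : nat -> R) :
  Rbar_lt 0 (CV_radius e) ->
  (forall eps, 0 < eps -> exists u, 0 < u < eps /\ PSeries e u = 0) ->
  e n = 0.
Proof.
  revert e.
  assert (H0 : forall e, Rbar_lt 0 (CV_radius e) ->
    (forall eps, 0 < eps -> exists u, 0 < u < eps /\ PSeries e u = 0) -> e 0%nat = 0).
  { intros e Hcv Hz. destruct (Req_dec (e 0%nat) 0) as [H|H]; [exact H|].
    destruct (continuous_pos_ball (PSeries e) (fun z => z <> 0)) as [d [Hd HP]].
    - apply continuous_PSeries. now rewrite Rabs_R0.
    - rewrite PSeries_0. now apply (open_neq 0).
    - destruct (Hz d Hd) as [u [Hu Hu0]]. exfalso. apply (HP u); [|exact Hu0].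
      rewrite Rabs_pos_eq; lra. }
  induction n as [|n IH]; intros e Hcv Hz; [now apply H0|].
  assert (He0 := H0 e Hcv Hz).
  change (e (S n)) with (PS_decr_1 e n). apply IH.
  - now rewrite CV_radius_decr_1.
  - intros eps Heps.
    assert (HR : exists R1, 0 < R1 /\ Rbar_lt R1 (CV_radius e)).
    { destruct (CV_radius e) as [c| |]; simpl in *.
      - exists (c / 2). lra.
      - exists 1. split; [lra|exact I].
      - tauto. }
    destruct HR as [R1 [HR1 HR2]].
    destruct (Hz (Rmin eps R1)) as [u [Hu Hu0]]; [now apply Rmin_pos|].
    pose proof (Rmin_l eps R1). pose proof (Rmin_r eps R1).
    exists u. split; [lra|].
    rewrite PSeries_decr_1, He0 in Hu0.
    + nra.
    + apply CV_radius_inside. rewrite Rabs_pos_eq by lra.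
      eapply Rbar_lt_trans; [|exact HR2]. simpl. lra.
Qed.

(** The series [e] of [d(u) + d(-u) - K] has zeros accumulating at [0], and its even coefficients
    are [2 d n], except the constant one, which absorbs [K]; hence the indices start at [2]. *)
Lemma even_coefficients (d : nat -> R) (K R1 : R) :
  0 < R1 -> Rbar_lt R1 (CV_radius d) ->
  (forall eps, 0 < eps -> exists u, 0 < u < eps /\ PSeries d u + PSeries d (- u) = K) ->
  forall m, d (2 * S m)%nat = 0.
Proof.
  intros HR Hcv Hz m.
  destruct (CV_radius_l1_bound d R1) as [M HM]; [lra|exact Hcv|].
  set (d' := fun n => (-1) ^ n * d n).
  assert (HM' : l1_bound R1 d' M).
  { intros n. rewrite (sum_eq _ (fun i => Rabs (d i) * R1 ^ i)); [apply HM|].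
    intros i _. unfold d'. now rewrite Rabs_mult, pow_1_abs, Rmult_1_l. }
  set (e := PS_plus (PS_plus d d') (PS_scal (- K) PS_one)).
  assert (He : l1_bound R1 e (M + M + Rabs (- K) * 1)).
  { apply l1_bound_plus; [lra| |apply l1_bound_scal, l1_bound_one].
    apply l1_bound_plus; [lra|exact HM|exact HM']. }
  assert (H : e (2 * S m)%nat = 0).
  { apply PSeries_accumulating_zeros.
    - eapply Rbar_lt_le_trans; [|apply (l1_bound_CV_radius R1 e _ (Rlt_le _ _ HR) He)].
      exact HR.
    - intros eps Heps. destruct (Hz (Rmin eps R1)) as [u [Hu Hu0]]; [now apply Rmin_pos|].
      pose proof (Rmin_l eps R1). pose proof (Rmin_r eps R1).
      exists u. split; [lra|].
      assert (Hua : Rabs u <= R1) by (rewrite Rabs_pos_eq; lra).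
      assert (E1 : ex_pseries d u) by (eexists; now apply (l1_bound_PSeries R1 _ M)).
      assert (E2 : ex_pseries d' u) by (eexists; now apply (l1_bound_PSeries R1 _ M)).
      unfold e. rewrite PSeries_plus, PSeries_plus, PSeries_scal, PSeries_one; auto.
      + replace (PSeries d' u) with (PSeries d (- u)); [lra|].
        unfold PSeries. apply Series_ext. intros n. unfold d'.
        replace (- u) with (-1 * u) by ring. rewrite Rpow_mult_distr. ring.
      + now apply ex_pseries_plus.
      + eexists; apply (l1_bound_PSeries R1 _ (Rabs (- K) * 1)); [|exact Hua].
        apply l1_bound_scal, l1_bound_one. }
  unfold e, d', PS_plus, PS_scal, plus, scal in H; simpl plus in H.
  replace (PS_one (2 * S m)) with 0 in H by now replace (2 * S m)%nat with (S (2 * m + 1)) by lia.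
  rewrite pow_1_even in H. unfold plus, mult in H; simpl in H.
  unfold mult in H; simpl in H.
  replace (2 * S m)%nat with (S (m + S (m + 0))) by lia. lra.
Qed.

Lemma even_series_factors (b : nat -> R) (R1 M : R) :
  0 < R1 -> l1_bound R1 b M -> (forall m, b (2 * m + 1)%nat = 0) ->
  exists F, locally 0 (fun s => analytic_at F s) /\
    forall u, Rabs u < R1 -> PSeries b u = F (u ^ 2 / 2).
Proof.
  intros HR Hb Hodd.
  (* In the variable [s = u^2 / 2] one has [u^(2 m) = 2^m s^m]. *)
  set (f := fun m => b (2 * m)%nat * 2 ^ m).
  assert (Hcv : Rbar_le (R1 ^ 2 / 2) (CV_radius f)).
  { apply CV_radius_bounded. exists M. intros n. unfold f.
    replace (b (2 * n)%nat * 2 ^ n * (R1 ^ 2 / 2) ^ n) with (b (2 * n)%nat * R1 ^ (2 * n)).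
    - rewrite Rabs_mult, (Rabs_pos_eq (R1 ^ _)) by (apply pow_le; lra).
      apply l1_bound_term; [lra|exact Hb].
    - rewrite Rmult_assoc, <- Rpow_mult_distr, pow_mult. do 2 f_equal. field. }
  assert (Hin : forall s, Rabs s < R1 ^ 2 / 2 -> Rbar_lt (Rabs s) (CV_radius f)).
  { intros s Hs. eapply Rbar_lt_le_trans; [|exact Hcv]. exact Hs. }
  exists (PSeries f). split.
  - apply (filter_imp (fun s => Rabs s < R1 ^ 2 / 2)).
    + intros s Hs. now apply analytic_at_PSeries, Hin.
    + apply locally_Rabs. rewrite Rabs_R0. nra.
  - intros u Hu.
    assert (Hu2 : Rabs (u ^ 2 / 2) < R1 ^ 2 / 2).
    { rewrite Rabs_pos_eq by (pose proof (pow2_ge_0 u); lra).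
      rewrite <- (pow2_abs u). pose proof (Rabs_pos u). nra. }
    assert (Ex : forall n, f n * (u ^ 2 / 2) ^ n = b (2 * n)%nat * (u ^ 2) ^ n).
    { intros n. unfold f. rewrite Rmult_assoc, <- Rpow_mult_distr. do 2 f_equal. field. }
    pose proof (CV_radius_inside _ _ (Hin _ Hu2)) as Hex.
    rewrite PSeries_odd_even.
    + rewrite (PSeries_ext (fun n => b (2 * n + 1)%nat) (PS_scal 0 PS_one)).
      * rewrite PSeries_scal, Rmult_0_l, Rmult_0_r, Rplus_0_r.
        unfold PSeries. symmetry. now apply Series_ext.
      * intros n. rewrite Hodd. unfold PS_scal, scal; simpl; unfold mult; simpl. ring.
    + apply ex_pseries_R. apply ex_pseries_R in Hex.
      now apply (ex_series_ext (fun n => f n * (u ^ 2 / 2) ^ n)).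
    + apply (ex_pseries_ext (PS_scal 0 PS_one)).
      * intros n. rewrite Hodd. unfold PS_scal, scal; simpl; unfold mult; simpl. ring.
      * apply ex_pseries_scal; [apply Rmult_comm|].
        eexists. apply (l1_bound_PSeries (Rabs (u ^ 2)) _ 1); [apply l1_bound_one|lra].
Qed.

(** * The functional equation and the odd part of the chart *)

Lemma odd_part_linear (g X D : R -> R) (r0 delta rho : R) (F : R -> R) :
  energy_chart g X D r0 delta -> rho < r0 ->
  (forall u, Rabs u < rho ->
    2 * potential g (X u) - X u * g (X u) = g (X u) * F (potential g (X u))) ->
  forall u, 0 < u < rho -> D u + D (- u) = 2.
Proof.
  intros chart Hrho HF.
  set (o := fun u => X u - X (- u)). set (o' := fun u => D u + D (- u)).
  (* Multiplying the equation by [D u] and using [g (X u) * D u = u] leaves a common factor [u] to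
     cancel. *)
  assert (HuX : forall u, u <> 0 -> Rabs u < rho -> u * D u - X u = F (u ^ 2 / 2)).
  { intros u Hu0 Hu. specialize (HF u Hu).
    assert (Hur : Rabs u < r0) by lra.
    rewrite (chart_potential chart) in HF by exact Hur.
    pose proof (chart_force chart u Hur) as Hg.
    apply Rmult_eq_reg_l with u; [|exact Hu0].
    apply (f_equal (Rmult (D u))) in HF.
    replace (D u * (2 * (u ^ 2 / 2) - X u * g (X u))) with
      (D u * u ^ 2 - X u * (g (X u) * D u)) in HF by field.
    replace (D u * (g (X u) * F (u ^ 2 / 2))) with ((g (X u) * D u) * F (u ^ 2 / 2)) in HF by ring.
    rewrite Hg in HF. lra. }
  (* The right-hand side is the same at [u] and [- u]; subtracting gives Euler's equation for degree
     one. *)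
  assert (Heuler : forall u, 0 < u < rho -> u * o' u = o u).
  { intros u Hu. unfold o', o.
    pose proof (HuX u ltac:(lra) ltac:(rewrite Rabs_pos_eq; lra)) as H1.
    pose proof (HuX (- u) ltac:(lra) ltac:(rewrite Rabs_Ropp, Rabs_pos_eq; lra)) as H2.
    replace ((- u) ^ 2) with (u ^ 2) in H2 by ring. lra. }
  assert (Ho : forall u, 0 < u < rho -> is_derive o u (o' u)).
  { intros u Hu. unfold o, o'.
    replace (D u + D (- u)) with (D u - (-1) * D (- u)) by ring.
    apply (is_derive_minus X (fun u => X (- u))).
    - apply (chart_derive chart). rewrite Rabs_pos_eq; lra.
    - apply (is_derive_comp X (fun u => - u)).
      + apply (chart_derive chart). rewrite Rabs_Ropp, Rabs_pos_eq; lra.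
      + auto_derive; [exact I|ring]. }
  (* [o u / u] is constant, hence so is [o'], which tends to [2] at [0]. *)
  assert (Hconst : forall v u, 0 < v < u -> u < rho -> o' v = o' u).
  { intros v u Hv Hu.
    destruct (MVT_gen (fun w => o w / w) v u (fun _ => 0)) as [c [_ Hc]].
    - rewrite Rmin_left, Rmax_right by lra. intros w Hw.
      assert (Hw' : 0 < w < rho) by lra.
      replace 0 with ((o' w * w - o w * 1) / w ^ 2)
        by (rewrite <- (Heuler w Hw'); field; lra).
      apply (is_derive_div o (fun w => w)); [now apply Ho|apply (is_derive_id (K := R_AbsRing))|lra].
    - rewrite Rmin_left, Rmax_right by lra. intros w Hw.
      assert (Hw' : 0 < w < rho) by lra.
      apply continuity_pt_div; [eapply is_derive_continuity_pt, Ho, Hw'| |lra].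
      apply derivable_continuous_pt, derivable_pt_id.
    - rewrite <- (Heuler v), <- (Heuler u) in Hc by lra.
      apply Rmult_eq_reg_r with 1; [|lra]. field_simplify in Hc; lra. }
  intros u Hu. change (o' u = 2).
  destruct (Req_dec (o' u) 2) as [H|H]; [exact H|exfalso].
  destruct (continuous_pos_ball o' (fun z => z <> o' u)) as [d [Hd HP]].
  - assert (HR : Rabs 0 < r0) by (rewrite Rabs_R0; lra).
    apply (continuous_plus D (fun u => D (- u))); [now apply (chart_continuous chart)|].
    apply (continuous_comp (fun u => - u) D).
    + apply (ex_derive_continuous (fun u => - u)). auto_derive. exact I.
    + apply (chart_continuous chart). now rewrite Rabs_Ropp.
  - apply (open_neq (o' u)). unfold o' at 1. rewrite Ropp_0, (chart_D0 chart). lra.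
  - set (v := Rmin d u / 2).
    assert (Hm : 0 < Rmin d u) by (apply Rmin_pos; lra).
    pose proof (Rmin_l d u). pose proof (Rmin_r d u).
    apply (HP v); [rewrite Rabs_pos_eq; unfold v; lra|]. apply Hconst; unfold v; lra.
Qed.

(** * Period constancy and the functional equation *)

Theorem mainTheorem9 (g : R -> R) (a b c : R)
  (g_analytic : forall x : R, analytic_at g x)
  (g0 : g 0 = 0)
  (g'0 : is_derive g 0 1)
  (a_lt0 : a < 0) (b_gt0 : 0 < b) (c_gt0 : 0 < c)
  (Ga : potential g a = c) (Gb : potential g b = c)
  (Gg_ab : forall x : R, a < x < b -> x <> 0 ->
     potential g x < c /\ 0 < x * g x) :
  isochronous_center_at_origin g <->
  exists F : R -> R,
    locally 0 (fun u => analytic_at F u) /\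
    locally 0 (fun x =>
      2 * potential g x - x * g x = g x * F (potential g x)).
Proof.
  destruct (energy_chart_exists g (g_analytic 0) g0 g'0) as [X [r0 [delta [Hcv chart]]]].
  pose proof (chart_radius chart) as Hr0.
  pose proof (chart_0 chart) as HX0.
  rewrite (isochronous_iff_period_constant chart). split.
  - intros [T [rho [Hrho HT]]].
    (* [D u + D (- u)] takes the value [T / PI] at arbitrarily small [u > 0], so all its nonconstant
       coefficients vanish. *)
    assert (Heven : forall m, PS_derive X (2 * S m)%nat = 0).
    { apply (even_coefficients _ (T / PI) rho); [lra| |].
      - rewrite CV_radius_derive. eapply Rbar_lt_trans; [|exact Hcv]. simpl. lra.
      - intros eps Heps.
        set (r := Rmin (rho / 2) (eps / 2)).
        assert (Hr : 0 < r /\ r <= rho / 2 /\ r <= eps / 2).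
        { unfold r. split; [apply Rmin_pos; lra|]. split; [apply Rmin_l|apply Rmin_r]. }
        clearbody r.
        destruct (period_constant_zero chart T r) as [u [Hu1 Hu2]]; [lra|apply HT; lra|].
        exists u. split; [lra|exact Hu2]. }
    (* The series of [u D u - X u], from which [F] is read off. *)
    set (b' := PS_minus (PS_incr_1 (PS_derive X)) X).
    assert (Hcvr : Rbar_lt rho (CV_radius X))
      by (eapply Rbar_lt_trans; [|exact Hcv]; simpl; lra).
    destruct (CV_radius_l1_bound X rho) as [M1 HM1]; [lra|exact Hcvr|].
    destruct (CV_radius_l1_bound (PS_incr_1 (PS_derive X)) rho) as [M2 HM2]; [lra| |].
    { now rewrite CV_radius_incr_1, CV_radius_derive. }
    assert (Hb : l1_bound rho b' (M2 + Rabs (-1) * M1)).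
    { intros n. rewrite (sum_eq _ (fun i => Rabs (PS_plus (PS_incr_1 (PS_derive X))
        (PS_scal (-1) X) i) * rho ^ i)).
      - apply l1_bound_plus; [lra|exact HM2|now apply l1_bound_scal].
      - intros i _. do 2 f_equal. unfold b', PS_minus, PS_opp, PS_plus, PS_scal.
        unfold plus, opp, scal; simpl; unfold mult; simpl. ring. }
    destruct (even_series_factors b' rho _ ltac:(lra) Hb) as [F [HF1 HF2]].
    (* Coefficient [1] cancels because [u D] and [X] have the same linear term; at higher odd
       indices that of [X] vanishes by [Heven]. *)
    { intros [|m].
      - unfold b', PS_minus, PS_plus, PS_opp, PS_incr_1, PS_derive, plus, opp; simpl. ring.
      - specialize (Heven m). unfold PS_derive in Heven.
        assert (HX : X (S (2 * S m)) = 0).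
        { apply Rmult_integral in Heven as [H|H]; [|exact H].
          exfalso. revert H. apply not_0_INR. lia. }
        replace (2 * S m + 1)%nat with (S (2 * S m)) by lia.
        unfold b', PS_minus, PS_plus, PS_opp, PS_incr_1, PS_derive. rewrite HX.
        unfold plus, opp; simpl. ring. }
    exists F. split; [exact HF1|].
    assert (Hrho2 : 0 < rho / 2 < r0) by lra.
    apply (filter_imp (fun x => PSeries X (- (rho / 2)) < x < PSeries X (rho / 2))).
    (* At [x = X u] both sides equal [u^2 - X u * g (X u)], by the force relation. *)
    + intros x Hx. destruct (chart_preimage chart (rho / 2) x Hrho2 Hx) as [u [Hu ->]].
      assert (Hur : Rabs u < r0) by lra.
      rewrite (chart_potential chart) by exact Hur.
      rewrite <- HF2 by lra.
      assert (Hucv : Rbar_lt (Rabs u) (CV_radius X))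
        by (eapply Rbar_lt_trans; [|exact Hcv]; simpl; lra).
      unfold b'. rewrite PSeries_minus, PSeries_incr_1.
      * pose proof (chart_force chart u Hur) as Hg.
        replace (g (PSeries X u) * (u * PSeries (PS_derive X) u - PSeries X u)) with
          (u * (g (PSeries X u) * PSeries (PS_derive X) u) - PSeries X u * g (PSeries X u)) by ring.
        rewrite Hg. field.
      * apply CV_radius_inside. now rewrite CV_radius_incr_1, CV_radius_derive.
      * now apply CV_radius_inside.
    + apply locally_between. now apply (chart_straddles_0 chart).
  - intros [F [_ HF]].
    (* Since [X 0 = 0], continuity pulls the equation back to a neighbourhood of [u = 0]. *)
    destruct (continuous_pos_ball (PSeries X) (fun x =>
      2 * potential g x - x * g x = g x * F (potential g x))) as [d [Hd HXd]].
    { apply continuous_PSeries. rewrite Rabs_R0. eapply Rbar_lt_trans; [|exact Hcv]. exact Hr0. }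
    { now rewrite HX0. }
    set (rho := Rmin (r0 / 2) d).
    assert (Hrho : 0 < rho /\ rho <= r0 / 2 /\ rho <= d).
    { unfold rho. split; [apply Rmin_pos; lra|]. split; [apply Rmin_l|apply Rmin_r]. }
    clearbody rho.
    exists (2 * PI), rho. split; [lra|].
    intros r Hr. apply (period_of_even_part chart rho); [lra| |exact Hr].
    apply (odd_part_linear g _ _ r0 delta rho F chart); [lra|].
    intros u Hu. apply HXd. lra.
Qed.
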